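(* Let $A$ be a finite alphabet, let $\#$ be a symbol not in $A$, and suppose a group $G$ admits a faithful veelike action on a language $L \subset A^*$. Let $X \subset (A \cup \{\#\})^{\mathbb Z}$ be the smallest subshift containing every configuration of the form $$ \ldots w_{-2} \# w_{-1} \# w_0 \# w_1 \# w_2 \# \ldots $$ with $w_i \in L$ for all $i \in \mathbb Z$. Then $G$ embeds in (i.e. is isomorphic to a subgroup of) the mapping class group $\mathrm{MCG}(X)$.
   Context: $A^*$ is the set of finite words over $A$, including the empty word $\epsilon$; $|u|$ is the length of $u$; a language is a subset of $A^*$. Veelike action: let $L \subset A^*$ be a language and $G$ a group. An action of $G$ on the set $L$ is veelike if for all $g \in G$ there exists $n \in \mathbb N$ such that for all $u \in A^*$ with $|u| = n$ there exists $u' \in A^*$ such that $g\cdot(uv) = u'v$ for all $v \in A^*$ with $uv \in L$. A subshift is a set of bi-infinite words over a finite alphabet defined by a set of forbidden finite words (equivalently, a closed shift-invariant set); $\sigma$ denotes the shift map, $\sigma(x)_i = x_{i+1}$. Mapping class group: let $X$ be a subshift. The mapping torus $\mathbf{S}X$ is the quotient space of $X \times \mathbb R$ by the equivalence relation $(x,t) \cong (\sigma^n(x), t-n)$ for $x \in X$, $t\in\mathbb R$, $n \in \mathbb Z$; write $[x,t]$ for the class of $(x,t)$. The path components of $\mathbf{S}X$ are the orbits of the $\mathbb R$-flow $r + [x,t] = [x,t+r]$, and self-homeomorphisms of $\mathbf{S}X$ map orbits onto orbits. Let $\mathcal F(X)$ be the group of self-homeomorphisms of $\mathbf{S}X$ which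 preserve the natural orientation of each orbit (the one given by the direction of the flow). Elements $f,g \in \mathcal F(X)$ are isotopic if there is a continuous map $h : [0,1]\times \mathbf{S}X \to \mathbf{S}X$ with $h(0,\cdot)=f$, $h(1,\cdot)=g$ and $h(t,\cdot) \in \mathcal F(X)$ for all $t\in[0,1]$. The mapping class group $\mathrm{MCG}(X)$ is the quotient of the group $\mathcal F(X)$ under isotopy. *)

(* Defs.v *)
From HB Require Import structures.
From mathcomp Require Import all_boot all_order all_algebra.
From mathcomp Require Import all_classical all_reals all_analysis.
From mathcomp Require Import ring lra.
Import numFieldNormedType.Exports.
Import Order.TTheory GRing.Theory Num.Theory.

Set Implicit Arguments.
Unset Strict Implicit.
Unset Printing Implicit Defensive.

Local Open Scope classical_set_scope.
Local Open Scope ring_scope.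

Section actions.
Variable G : groupType.

Definition is_action (T : Type) (act : G -> T -> T) : Prop :=
  (forall u, act 1%g u = u) /\
  (forall g h u, act (g * h)%g u = act g (act h u)).

Definition faithful_action (T : Type) (act : G -> T -> T) : Prop :=
  forall g, (forall u, act g u = u) -> g = 1%g.

Definition veelike (A : Type) (L : set (seq A)) (act : G -> L -> L) : Prop :=
  forall g, exists n : nat, forall u : seq A, size u = n ->
    exists u' : seq A, forall (v : seq A) (w : L),
      \val w = u ++ v -> \val (act g w) = u' ++ v.

End actions.

Section subshifts.

Definition fullshift (S : choiceType) : Type :=
  {ptws int -> discrete_topology S}.

HB.instance Definition _ (S : choiceType) :=
  Topological.copy (fullshift S) {ptws int -> discrete_topology S}.

Definition shift (S : choiceType) (n : int) (x : fullshift S) : fullshift S :=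
  fun i => x (i + n).

Definition factor (S : choiceType) (x : fullshift S) (i : int) (n : nat) :
  seq S := [seq x (i + k%:Z) | k <- iota 0 n].

Definition is_subshift (S : finType) (X : set (fullshift S)) : Prop :=
  exists F : set (seq S),
    X = [set x | forall i w, F w -> factor x i (size w) <> w].

(* The alphabet A together with a symbol # outside A is [option A], with # the
   element [None].  Here [p i] is the position of the # preceding [w i]; since
   [p (i + 1) - p i >= 1], the blocks # w_i cover the whole of int. *)
Definition marked_concat (A : finType) (w : int -> seq A)
    (x : fullshift (option A)) : Prop :=
  exists p : int -> int, forall i,
    p (i + 1) = p i + (size (w i)).+1%:Z /\
    factor x (p i) (size (w i)).+1 = None :: [seq Some a | a <- w i].

Definition marker_shift (A : finType) (L : set (seq A)) :
    set (fullshift (option A)) :=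
  smallest (@is_subshift (option A))
    [set x | exists2 w, (forall i, L (w i)) & marked_concat w x].

Lemma marker_shift_subshift (A : finType) (L : set (seq A)) :
  is_subshift (marker_shift L).
Proof.
exists [set w | forall x : fullshift (option A), marker_shift L x ->
          forall i, factor x i (size w) <> w].
apply/seteqP; split=> x /=; first by move=> Xx i w; apply.
move=> Fx M [[F ->] GF] i w Fw; apply: Fx => y Xy j.
by apply: (Xy [set x | forall i w, F w -> factor x i (size w) <> w] _ j w Fw);
  split => //; exists F.
Qed.

End subshifts.

Section homeomorphisms.

Definition homeomorphism (T U : topologicalType) (f : T -> U) : Prop :=
  exists g : U -> T, [/\ continuous f, continuous g, cancel f g & cancel g f].

Lemma homeomorphism_id (T : topologicalType) : homeomorphism (@idfun T).
Proof. by exists idfun; split => //; move=> x; exact: cvg_id. Qed.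

Lemma homeomorphism_comp (T U V : topologicalType) (f : U -> V) (g : T -> U) :
  homeomorphism f -> homeomorphism g -> homeomorphism (f \o g).
Proof.
move=> [f' [cf cf' fK f'K]] [g' [cg cg' gK g'K]]; exists (g' \o f'); split.
- by move=> x; apply: continuous_comp; [exact: cg|exact: cf].
- by move=> x; apply: continuous_comp; [exact: cf'|exact: cg'].
- exact: can_comp.
- exact: can_comp.
Qed.

Lemma within_comp (T U V : topologicalType) (B : set T) (A : set U)
    (h : U -> V) (u : T -> U) :
  {within A, continuous h} -> continuous u -> (forall x, B x -> A (u x)) ->
  {within B, continuous (h \o u)}.
Proof.
move=> ch cu BA; rewrite continuous_subspace_in => x /set_mem Bx W nW.
have nA : within A (nbhs (u x)) (h @^-1` W).
  by rewrite (nbhs_subspace_in (BA _ Bx)); exact: (ch (u x) W nW).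
suff : within B (nbhs x) ((h \o u) @^-1` W) by rewrite (nbhs_subspace_in Bx).
have := cu x _ nA; rewrite /within /= nbhs_simpl /=.
by apply: filterS => y /= + By; apply; exact: BA.
Qed.

End homeomorphisms.

Section mapping_torus.
Variables (R : realType) (S : finType) (X : set (fullshift S)).
Local Open Scope quotient_scope.

Definition torus_rel (a b : X * R) : bool :=
  `[< exists n : int, \val b.1 = shift n (\val a.1) /\ b.2 = a.2 - n%:~R >].

Lemma torus_rel_refl : reflexive torus_rel.
Proof.
move=> a; apply/asboolP; exists 0; rewrite subr0; split => //.
by apply/funext => i; rewrite /shift addr0.
Qed.

Lemma torus_rel_sym : symmetric torus_rel.
Proof.
suff H a b : torus_rel a b -> torus_rel b a by move=> a b; apply/idP/idP; exact: H.
move=> /asboolP[n [e1 e2]]; apply/asboolP; exists (- n); split.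
  by rewrite e1; apply/funext => i; rewrite /shift subrK.
by rewrite e2 mulrNz opprK subrK.
Qed.

Lemma torus_rel_trans : transitive torus_rel.
Proof.
move=> b a c /asboolP[n [e1 e2]] /asboolP[m [e3 e4]]; apply/asboolP.
exists (m + n); split.
  by rewrite e3 e1; apply/funext => i; rewrite /shift addrA.
by rewrite e4 e2 intrD opprD addrA -!addrA (addrC (- _)).
Qed.

Definition torus_equiv :=
  EquivRel torus_rel torus_rel_refl torus_rel_sym torus_rel_trans.

Definition mapping_torus : Type := {eq_quot torus_equiv}.

HB.instance Definition _ :=
  Topological.copy mapping_torus (quotient_topology {eq_quot torus_equiv}).
HB.instance Definition _ := Quotient.copy mapping_torus {eq_quot torus_equiv}.

Definition flow (r : R) (z : mapping_torus) : mapping_torus :=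
  \pi_mapping_torus ((repr z).1, (repr z).2 + r).

Lemma flow_pi (r : R) (a : X * R) :
  flow r (\pi_mapping_torus a) = \pi_mapping_torus (a.1, a.2 + r).
Proof.
rewrite /flow; case: piP => b /eqmodP/asboolP[n [e1 e2]].
apply/eqmodP/asboolP; exists (- n) => /=; split.
  by rewrite e1; apply/funext => i; rewrite /shift subrK.
by rewrite e2 mulrNz opprK addrAC subrK.
Qed.

(* In the flow parametrisations r |-> r + z of the orbit of z and
   r |-> r + f z of the orbit of f z, the restriction of f is an increasing
   homeomorphism of the real line; for a circular orbit, phi is a lift. *)
Definition orientation_preserving (f : mapping_torus -> mapping_torus) : Prop :=
  forall z, exists phi : R -> R,
    [/\ homeomorphism phi, {homo phi : s t / s < t} &
        forall r, f (flow r z) = flow (phi r) (f z)].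

Definition ophomeo_set : set (mapping_torus -> mapping_torus) :=
  [set f | homeomorphism f /\ orientation_preserving f].

Definition ophomeo : Type := set_type ophomeo_set.

HB.instance Definition _ := Choice.copy ophomeo (set_type ophomeo_set).
HB.instance Definition _ :=
  SubType.copy ophomeo (set_type ophomeo_set).

Lemma ophomeo_id : ophomeo_set idfun.
Proof.
split; first exact: homeomorphism_id.
by move=> z; exists idfun; split => //; exact: homeomorphism_id.
Qed.

Lemma ophomeo_comp f g : ophomeo_set f -> ophomeo_set g -> ophomeo_set (f \o g).
Proof.
move=> [hf of_] [hg og]; split; first exact: homeomorphism_comp.
move=> z; have [p [hp ip pE]] := og z; have [q [hq iq qE]] := of_ (g z).
exists (q \o p); split; first exact: homeomorphism_comp.
  by move=> s t st; apply/iq/ip.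
by move=> r /=; rewrite pE qE.
Qed.

Lemma ophomeo_inv_ex (f : ophomeo) :
  exists g : ophomeo, cancel (\val f) (\val g) /\ cancel (\val g) (\val f).
Proof.
case: f => f /= /set_mem[[g [cf cg fK gK]] of_].
suff Pg : ophomeo_set g by exists (SigSub (mem_set Pg)).
split; first by exists f.
move=> z; have [p [[q [cp cq pK qK]] ip pE]] := of_ (g z).
exists q; split; first by exists p.
  by move=> s t; rewrite !ltNge; apply: contraNN => /(ltW_homo ip); rewrite !qK.
by move=> r; rewrite -[r in LHS]qK -{1}[z]gK -pE fK.
Qed.

Definition ophomeo1 : ophomeo := SigSub (mem_set ophomeo_id).

Definition ophomeoM (f g : ophomeo) : ophomeo :=
  SigSub (mem_set (ophomeo_comp (set_mem (valP f)) (set_mem (valP g)))).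

Definition ophomeoV (f : ophomeo) : ophomeo := sval (cid (ophomeo_inv_ex f)).

Fact ophomeoA : associative ophomeoM.
Proof. by move=> f g h; apply: val_inj. Qed.
Fact ophomeo1M : left_id ophomeo1 ophomeoM.
Proof. by move=> f; apply: val_inj. Qed.
Fact ophomeoM1 : right_id ophomeo1 ophomeoM.
Proof. by move=> f; apply: val_inj. Qed.
Fact ophomeoVM : left_inverse ophomeo1 ophomeoV ophomeoM.
Proof.
move=> f; apply: val_inj; rewrite /ophomeoV; case: cid => g [fK gK] /=.
by apply/funext => z /=; rewrite fK.
Qed.
Fact ophomeoMV : right_inverse ophomeo1 ophomeoV ophomeoM.
Proof.
move=> f; apply: val_inj; rewrite /ophomeoV; case: cid => g [fK gK] /=.
by apply/funext => z /=; rewrite gK.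
Qed.

HB.instance Definition _ :=
  isGroup.Build ophomeo ophomeoA ophomeo1M ophomeoM1 ophomeoVM ophomeoMV.

Definition isotopic (f g : ophomeo) : bool :=
  `[< exists h : R * mapping_torus -> mapping_torus,
      [/\ {within `[0, 1]%classic `*` setT, continuous h},
          (forall t, t \in `[0, 1] -> ophomeo_set (fun z => h (t, z))),
          (forall z, h (0, z) = \val f z) &
          (forall z, h (1, z) = \val g z)] >].

Lemma ophomeo_continuous (f : ophomeo) : continuous (\val f).
Proof. by case: f => f /= /set_mem[[g []]]. Qed.

Lemma isotopic_refl : reflexive isotopic.
Proof.
move=> f; apply/asboolP; exists (fun p => \val f p.2); split => //.
  apply: continuous_subspaceT => p.
  by apply: continuous_comp; [exact: cvg_snd|exact: ophomeo_continuous].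
by move=> t _; exact: set_mem (valP f).
Qed.

Lemma isotopic_sym : symmetric isotopic.
Proof.
suff H f g : isotopic f g -> isotopic g f by move=> f g; apply/idP/idP; exact: H.
move=> /asboolP[h [ch hP h0 h1]]; apply/asboolP.
exists (h \o (fun p => (1 - p.1, p.2))); split => /=.
- apply: (within_comp ch) => [p|[t z] [/= t01 _]].
    apply: (@cvg_pair _ _ _ _ (nbhs (1 - p.1)) (nbhs p.2)).
      by apply: cvgB; [exact: cvg_cst|exact: cvg_fst].
    exact: cvg_snd.
  by split => //=; move: t01; rewrite !in_itv /=; lra.
- by move=> t t01; apply: hP; move: t01; rewrite !in_itv /=; lra.
- by move=> z; rewrite subr0 h1.
- by move=> z; rewrite subrr h0.
Qed.

Lemma isotopic_trans : transitive isotopic.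
Proof.
move=> g f k /asboolP[h [ch hP h0 h1]] /asboolP[l [cl lP l0 l1]].
apply/asboolP.
pose m (p : R * mapping_torus) :=
  if p.1 <= 2^-1 then h (2 * p.1, p.2) else l (2 * p.1 - 1, p.2).
have mul2_cont : continuous (fun p : R * mapping_torus => 2 * p.1 : R).
  by move=> p; apply: cvgM; [exact: cvg_cst|exact: cvg_fst].
have m0 (t : R) z : t <= 2^-1 -> m (t, z) = h (2 * t, z).
  by rewrite /m /= => ->.
have m1 (t : R) z : 2^-1 <= t -> m (t, z) = l (2 * t - 1, z).
  move=> t1; rewrite /m /=; case: ifPn => // t2.
  have -> : t = 2^-1 by lra.
  by rewrite mulfV ?pnatr_eq0// subrr l0 h1.
exists m; split.
- have -> : `[0, 1]%classic `*` setT =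
      (`[0, 2^-1]%classic `*` setT) `|` (`[2^-1, 1]%classic `*` setT)
      :> set (R * mapping_torus).
    apply/seteqP; split=> -[t z] /=; rewrite !in_itv /=.
      by case: (lerP t 2^-1) => t2 [/andP[t0 t1] _]; [left|right];
        rewrite ?t0 ?t1 ?(ltW t2).
    by case=> -[/andP[t0 t1] _]; split => //; apply/andP; split; lra.
  have clX (a b : R) : closed (`[a, b]%classic `*` @setT mapping_torus).
    rewrite (_ : _ `*` _ = fst @^-1` `[a, b]%classic); last first.
      by apply/seteqP; split=> -[t z] //= [].
    by apply: preimage_closed => [p _|]; [exact: cvg_fst|exact: itv_closed].
  apply: withinU_continuous; [exact: clX|exact: clX| |].
  + apply: (@subspace_eq_continuous _ _ _ (h \o (fun p => (2 * p.1, p.2)))).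
      by move=> [t z] /set_mem[/=]; rewrite in_itv /= => /andP[_ t1] _;
        exact: esym (m0 t z t1).
    apply: (within_comp ch) => [p|[t z] [/= + _]].
      by apply: (@cvg_pair _ _ _ _ (nbhs (2 * p.1 : R)) (nbhs p.2)); [exact: mul2_cont|exact: cvg_snd].
    by split => //=; move: a; rewrite !in_itv /=; lra.
  + apply: (@subspace_eq_continuous _ _ _ (l \o (fun p => (2 * p.1 - 1, p.2)))).
      by move=> [t z] /set_mem[/=]; rewrite in_itv /= => /andP[t1 _] _;
        exact: esym (m1 t z t1).
    apply: (within_comp cl) => [p|[t z] [/= + _]].
      apply: (@cvg_pair _ _ _ _ (nbhs (2 * p.1 - 1 : R)) (nbhs p.2));
        last exact: cvg_snd.
      by apply: cvgB; [exact: mul2_cont|exact: cvg_cst].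
    by split => //=; move: a; rewrite !in_itv /=; lra.
- move=> t; rewrite in_itv /= => /andP[t0 t1].
  case: (lerP t 2^-1) => t2.
    rewrite (_ : (fun z => m (t, z)) = fun z => h (2 * t, z)); last first.
      by apply/funext => z; rewrite m0.
    by apply: hP; rewrite in_itv /=; lra.
  rewrite (_ : (fun z => m (t, z)) = fun z => l (2 * t - 1, z)); last first.
    by apply/funext => z; rewrite m1// ltW.
  by apply: lP; rewrite in_itv /=; lra.
- by move=> z; rewrite m0 ?mulr0// invr_ge0 ler0n.
- move=> z; rewrite m1; last by lra.
  by rewrite (_ : 2 * 1 - 1 = 1) ?l1//; ring.
Qed.

Definition isotopy_equiv :=
  EquivRel isotopic isotopic_refl isotopic_sym isotopic_trans.

Lemma isotopicM (f f' g g' : ophomeo) :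
  isotopic f f' -> isotopic g g' -> isotopic (f * g)%g (f' * g')%g.
Proof.
move=> /asboolP[h [ch hP h0 h1]] /asboolP[l [cl lP l0 l1]].
apply: (@isotopic_trans (f' * g)%g); apply/asboolP.
- exists (h \o (fun p => (p.1, \val g p.2))); split => /=.
  + apply: (within_comp ch) => [p|[t z] [/= + _]]; last by split.
    apply: (@cvg_pair _ _ _ _ (nbhs p.1) (nbhs (\val g p.2)));
      first exact: cvg_fst.
    by apply: continuous_comp; [exact: cvg_snd|exact: ophomeo_continuous].
  + by move=> t /hP; move/ophomeo_comp; apply; exact: set_mem (valP g).
  + by move=> z; rewrite h0.
  + by move=> z; rewrite h1.
- exists (\val f' \o l); split => /=.
  + move=> p; apply: (@continuous_comp (subspace _) _ _ l); first exact: cl.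
    exact: ophomeo_continuous.
  + by move=> t /lP; apply: (ophomeo_comp (set_mem (valP f'))).
  + by move=> z; rewrite l0.
  + by move=> z; rewrite l1.
Qed.

Definition MCG : Type := {eq_quot isotopy_equiv}.

HB.instance Definition _ := Choice.copy MCG {eq_quot isotopy_equiv}.
HB.instance Definition _ := Quotient.copy MCG {eq_quot isotopy_equiv}.

Definition MCG1 : MCG := \pi_MCG 1%g.
Definition MCGM (a b : MCG) : MCG := \pi_MCG (repr a * repr b)%g.
Definition MCGV (a : MCG) : MCG := \pi_MCG (repr a)^-1%g.

Lemma MCG_pi_eq (f g : ophomeo) : isotopic f g -> \pi_MCG f = \pi_MCG g.
Proof. by move=> fg; apply/eqmodP. Qed.

Lemma MCG_repr_pi (f : ophomeo) : isotopic (repr (\pi_MCG f)) f.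
Proof.
by apply/(@eqmodP _ isotopy_equiv); exact: (reprK (\pi_MCG f)).
Qed.

Fact MCGM_pi (f g : ophomeo) : MCGM (\pi_MCG f) (\pi_MCG g) = \pi_MCG (f * g)%g.
Proof. by apply/MCG_pi_eq/isotopicM; exact: MCG_repr_pi. Qed.

Fact MCG_surj (a : MCG) : exists f, a = \pi_MCG f.
Proof. by exists (repr a); rewrite reprK. Qed.

Fact MCGA : associative MCGM.
Proof.
move=> a b c; case: (MCG_surj a) (MCG_surj b) (MCG_surj c) => f -> [g ->] [h ->].
by rewrite !MCGM_pi mulgA.
Qed.
Fact MCG1M : left_id MCG1 MCGM.
Proof. by move=> a; case: (MCG_surj a) => f ->; rewrite MCGM_pi mul1g. Qed.
Fact MCGM1 : right_id MCG1 MCGM.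
Proof. by move=> a; case: (MCG_surj a) => f ->; rewrite MCGM_pi mulg1. Qed.
Fact MCGVM : left_inverse MCG1 MCGV MCGM.
Proof.
by move=> a; rewrite -{2}[a](reprK (a : MCG)) MCGM_pi mulVg.
Qed.
Fact MCGMV : right_inverse MCG1 MCGV MCGM.
Proof.
by move=> a; rewrite -{1}[a](reprK (a : MCG)) MCGM_pi mulgV.
Qed.

HB.instance Definition _ :=
  isGroup.Build MCG MCGA MCG1M MCGM1 MCGVM MCGMV.

End mapping_torus.

(* Main.v *)
From HB Require Import structures.
From mathcomp Require Import all_boot all_order all_algebra.
From mathcomp Require Import all_classical all_reals all_analysis.
From mathcomp Require Import ring lra zify.
Require Import Defs.
Import numFieldNormedType.Exports.
Import Order.TTheory GRing.Theory Num.Theory.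

(** An element g of the group acts on a bi-infinite concatenation of blocks
    # w_i by applying g to every w_i.  Lengths of blocks change, so this is not a
    map of the subshift, but it is a map of the mapping torus once it is decided
    how time runs inside a block.  The isotopy class does not depend on this
    choice; here it is made so that composition is respected on the nose, and
    isotopies only enter the proof of injectivity.

    Measure time in a block from the first letter of w, so that the symbol #
    occupies the times in [-1, 0].  [depth] is a decreasing bijection from
    ]-1, oo[ to the line with depth t = - t on the letters, and size w + depth t
    parametrises the block, from its right end, by [0, oo[.  The block # w is
    mapped to # (g w) by keeping this parameter.  In terms of t this is the
    homeomorphism [slide d] with d = size (g w) - size w, the conjugate under
    [depth] of the translation by - d.  It depends on d alone, slides compose by
    addition ([slideD]), and slide d t = t + d away from the symbol #: a change
    of length is absorbed by #, and what lies further right is translated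
    rigidly.

    Since g only rewrites prefixes of a bounded length n, and so changes lengths
    by a bounded amount C, the image of a concatenation, aligned with its source
    at the first marker after the origin, is determined near the origin by the
    source near the origin ([locality], [is_image_local]).  Hence the
    construction extends from concatenations to their limits, in which blocks
    may be infinite ([limit_image_exists]).  Since the time spent in the image
    of a unit of time is bounded below, the extension reparametrises each orbit
    by an increasing homeomorphism of the line, and the resulting self-map of
    the mapping torus is continuous ([time_changed_continuous],
    [time_changed_orientation], [rewriting_flow_exists]).  The mapping torus is
    Hausdorff and the orbits of concatenations are dense, so these maps form an
    action of the group because they do so on concatenations ([act_flowM]); in
    particular they are homeomorphisms.

    For injectivity, a path in the mapping torus stays in one orbit, the
    symbolic coordinate being locally constant along it ([path_in_orbit]).  If g
    acts by a map isotopic to the identity, then the image of the periodic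
    configuration with all blocks equal to u lies in the orbit of that
    configuration.  All blocks of the image are g u, so g u = u
    ([act_flow_faithful]), for every u in the language. *)

Set Implicit Arguments.
Unset Strict Implicit.
Unset Printing Implicit Defensive.

Local Open Scope classical_set_scope.
Local Open Scope ring_scope.

(** * Neighbourhoods and paths in mapping tori *)

Definition agree (S : Type) (N : nat) (x y : int -> S) : Prop :=
  forall i : int, (`|i| <= N)%N -> x i = y i.

Lemma agreeW (S : Type) (N N' : nat) (x y : int -> S) :
  (N <= N')%N -> agree N' x y -> agree N x y.
Proof. by move=> NN' xy i iN; apply: xy; exact: leq_trans NN'. Qed.

Lemma agree_sym (S : Type) (N : nat) (x y : int -> S) : agree N x y -> agree N y x.
Proof. by move=> xy i iN; rewrite xy. Qed.

Lemma agree_trans (S : Type) (N : nat) (x y z : int -> S) :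
  agree N x y -> agree N y z -> agree N x z.
Proof. by move=> xy yz i iN; rewrite xy // yz. Qed.

Lemma agree_shift (S : choiceType) (N : nat) (n : int) (x y : fullshift S) :
  agree (N + `|n|) x y -> agree N (shift n x) (shift n y).
Proof. by move=> xy i iN; apply: xy; lia. Qed.

Lemma shiftD (S : choiceType) (n m : int) (x : fullshift S) :
  shift n (shift m x) = shift (n + m) x.
Proof. by apply/funext => i; rewrite /shift addrA. Qed.

Lemma shift0 (S : choiceType) (x : fullshift S) : shift 0 x = x.
Proof. by apply/funext => i; rewrite /shift addr0. Qed.

(** The window of [agree N] as a list, to intersect finitely many
    neighbourhoods by induction. *)
Definition int_range (N : nat) : seq int := [seq (k%:Z - N%:Z) | k <- iota 0 (N + N).+1].

Lemma mem_int_range N (i : int) : (i \in int_range N) = (`|i| <= N)%N.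
Proof.
apply/mapP/idP => [[k + ->]|iN]; first by rewrite mem_iota; lia.
by exists (absz (i + N%:Z)); [rewrite mem_iota; lia|lia].
Qed.

Lemma nbhs_agree (S : choiceType) (x : fullshift S) (N : nat) :
  nbhs x [set y | agree N x y].
Proof.
have ev (i : int) : nbhs x [set y : fullshift S | x i = y i].
  have /(_ [set a | x i = a])/= := @proj_continuous int (fun=> discrete_topology S) i x.
  apply; apply: (filterS _ (discrete_set1 (x i : discrete_topology S))).
  by move=> a ->.
have : nbhs x [set y : fullshift S | forall i, i \in int_range N -> x i = y i].
  elim: (int_range N) => [|i s ih]; first by apply: filterS filterT.
  apply: filterS (filterI (ev i) ih) => y [/= xi xs] j.
  by rewrite inE => /orP[/eqP -> //|/xs].
by apply: filterS => y /= xy i iN; apply: xy; rewrite mem_int_range.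
Qed.

Lemma nbhs_fullshift (S : choiceType) (x : fullshift S) (U : set (fullshift S)) :
  nbhs x U <-> exists N, forall y : fullshift S, agree N x y -> U y.
Proof.
split; last by case=> N HN; apply: filterS (nbhs_agree x N) => y; exact: HN.
pose F : set_system (fullshift S) :=
  [set V | exists N, forall y : fullshift S, agree N x y -> V y].
have FF : Filter F.
  split; first by exists 0%N.
    move=> P Q [N HN] [N' HN']; exists (maxn N N') => y xy; split.
      by apply: HN; apply: agreeW xy; rewrite leq_maxl.
    by apply: HN'; apply: agreeW xy; rewrite leq_maxr.
  by move=> P Q PQ [N HN]; exists N => y xy; apply/PQ/HN.
suff : F --> x by exact.
apply/cvg_sup => i; apply/cvg_image.
  by rewrite eqEsubset; split=> // a _; exists (fun=> a).
move=> V Vi; exists [set y : fullshift S | V (y i)].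
  exists `|i|%N => y xy /=; rewrite -(xy i)//; exact: nbhs_singleton Vi.
rewrite eqEsubset; split => [a [y /= Vy <-] //|a Va].
by exists (fun=> a).
Qed.

Section mapping_torus_topology.
Local Open Scope quotient_scope.
Variables (R : realType) (S : finType) (X : set (fullshift S)).
Hypothesis shiftX : forall n x, X x -> X (shift n x).

Definition sshift (n : int) (x : X) : X :=
  SigSub (mem_set (shiftX n (set_mem (valP x)))).

Lemma nbhs_subshift (x : X) (U : set X) :
  nbhs x U <-> exists N, forall y : X, agree N (\val x) (\val y) -> U y.
Proof.
split.
  rewrite nbhsE => -[V [[W oW WV] Vx] VU].
  have /nbhs_fullshift[N HN] : nbhs (\val x : fullshift S) W.
    by apply: open_nbhs_nbhs; split => //; move: Vx; rewrite -WV.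
  by exists N => y xy; apply: VU; rewrite -WV; exact: HN xy.
move=> [N HN].
suff : nbhs x [set y : X | agree N (\val x) (\val y)].
  by apply: filterS => y; exact: HN.
exact: (@initial_continuous X (fullshift S) set_val x _ (nbhs_agree (\val x) N)).
Qed.

Lemma nbhs_suspension (x : X) (t : R) (U : set (X * R)) :
  nbhs (x, t) U <-> exists N, exists2 e : R, 0 < e &
    forall (y : X) s, agree N (\val x) (\val y) -> `|t - s| < e -> U (y, s).
Proof.
split.
  move=> [[V W] /= [/nbhs_subshift[N HN] /nbhs_ballP[e /= e0 He]] VW].
  by exists N, e => // y s xy ts; apply: VW; split; [exact: HN|exact: He].
move=> [N [e e0 HN]].
exists ([set y : X | agree N (\val x) (\val y)], ball t e).
  by split; [apply/nbhs_subshift; exists N|exact: nbhsx_ballx].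
by move=> [y s] [/= xy ts]; exact: HN.
Qed.

Local Notation SX := (mapping_torus R X).
(** The class of (x, t), with values in a type that hides the quotient. *)
Definition torus_pt (x : X) (t : R) : SX := \pi_SX (x, t).

Lemma torus_ptE (a : X * R) : torus_pt a.1 a.2 = \pi_SX a.
Proof. by case: a. Qed.

Lemma torus_ptP (z : SX) : exists x t, z = torus_pt x t.
Proof. by exists (repr z).1, (repr z).2; rewrite torus_ptE reprK. Qed.

Lemma eq_torus_pt x t y s :
  torus_pt x t = torus_pt y s <-> exists n : int, y = sshift n x /\ s = t - n%:~R.
Proof.
split.
  move=> /eqmodP/asboolP[n [/= e1 e2]]; exists n; split => //.
  by apply: val_inj; exact: e1.
by move=> [n [-> ->]]; apply/eqmodP/asboolP; exists n.
Qed.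

Lemma torus_pt_shift n x t : torus_pt (sshift n x) t = torus_pt x (t + n%:~R).
Proof. by apply/esym/eq_torus_pt; exists n; rewrite addrK. Qed.

Lemma flow_torus_pt r x t : flow r (torus_pt x t) = torus_pt x (t + r).
Proof. exact: flow_pi. Qed.

Lemma continuous_torus_pt : continuous (fun a : X * R => torus_pt a.1 a.2).
Proof.
have -> : (fun a : X * R => torus_pt a.1 a.2) = \pi_SX.
  by apply/funext => b; rewrite torus_ptE.
by apply/continuousP => U.
Qed.

(** The quotient map is open: the saturation of an open set is the union of
    its translates under the deck transformations. *)
Lemma nbhs_torus_pt x t (U : set SX) :
  nbhs (torus_pt x t) U <-> exists N, exists2 e : R, 0 < e &
    forall (y : X) s, agree N (\val x) (\val y) -> `|t - s| < e -> U (torus_pt y s).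
Proof.
split; first by move=> /(@continuous_torus_pt (x, t))/nbhs_suspension.
move=> [N [e e0 HN]].
pose W := [set z | exists y s,
  [/\ z = torus_pt y s, agree N (\val x) (\val y) & `|t - s| < e]].
rewrite nbhsE; exists W; last by move=> z [y [s [-> ? ?]]]; exact: HN.
split; last by exists x, t; rewrite subrr normr0.
suff : open (\pi_SX @^-1` W) by [].
rewrite openE => -[y s] [y' [s' [/esym ys xy' ts']]].
rewrite /interior; apply/nbhs_suspension.
move: ys; rewrite -/(torus_pt y s) => /eq_torus_pt[n [yE sE]].
exists (N + `|n|)%N, (e - `|t - s'|); first by rewrite subr_gt0.
move=> v r yv sr /=; exists (sshift (- n) v), (r + n%:~R); split.
- by rewrite -[LHS]/(torus_pt v r) torus_pt_shift mulrNz addrK.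
- apply: agree_trans xy' _.
  have -> : y' = sshift (- n) y.
    by rewrite yE; apply: val_inj; rewrite /= shiftD addNr shift0.
  by apply: agree_shift; rewrite abszN.
- rewrite sE in sr; have : `|t - (r + n%:~R)| <= `|t - s'| + `|s' - n%:~R - r|.
    apply: le_trans (ler_normD _ _); rewrite [X in _ <= `|X|](_ : _ = t - (r + n%:~R))//.
    by ring.
  lra.
Qed.

(** For two points that no open sets separate, the difference of times is within
    any e of an integer, so it is an integer n0, the only candidate for the
    translation.  The configurations are then compared one coordinate at a
    time. *)
Lemma mapping_torus_hausdorff : hausdorff_space SX.
Proof.
move=> p q; have [x [t ->]] := torus_ptP p; have [y [s ->]] := torus_ptP q => cl.
have near N (e : R) : 0 < e -> exists n : int, `|t - s - n%:~R| < e + e /\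
    exists x' : X, agree N (\val x) (\val x') /\
                   agree N (\val y) (shift n (\val x')).
  move=> e0; pose A (x : X) (t : R) := [set z | exists y s,
    [/\ z = torus_pt y s, agree N (\val x) (\val y) & `|t - s| < e]].
  have nA x' t' : nbhs (torus_pt x' t') (A x' t').
    by apply/nbhs_torus_pt; exists N, e => // y' s' ? ?; exists y', s'.
  have [z [[x' [t' [-> xx' tt']]] [y' [s' [/eq_torus_pt[n [-> ->]] yy' ss']]]]] :=
    cl _ _ (nA x t) (nA y s).
  exists n; split; last by exists x'.
  by move: tt' ss'; rewrite !ltr_norml => /andP[? ?] /andP[? ?]; apply/andP; split; lra.
have [n0 [tsn0 _]] : _ := near 0%N 4^-1 ltac:(lra).
have uniq (n : int) : `|t - s - n%:~R| < 2^-1 -> n = n0.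
  move=> tsn; have : `|(n - n0)%:~R : R| < 1%:~R.
    rewrite intrB; move: tsn0 tsn; rewrite !ltr_norml => /andP[? ?] /andP[? ?].
    by apply/andP; split; lra.
  by rewrite -intr_norm ltr_int; lia.
have tsE : t - s = n0%:~R.
  apply/eqP; rewrite -subr_eq0; apply/negP => /negP ne.
  have n0' : 0 < `|t - s - n0%:~R| by rewrite normr_gt0.
  pose e := Num.min 4^-1 (`|t - s - n0%:~R| / 2).
  have e0 : 0 < e by rewrite lt_min; apply/andP; split; lra.
  have [n [tsn _]] := near 0%N _ e0.
  have e1 : e <= 4^-1 by rewrite ge_min lexx.
  have e2 : e <= `|t - s - n0%:~R| / 2 by rewrite ge_min lexx orbT.
  have nE : n = n0 by apply: uniq; lra.
  by rewrite nE in tsn; lra.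
apply/eq_torus_pt; exists n0; split; last by rewrite -tsE; lra.
apply: val_inj; apply/funext => i.
have [n [tsn [x' [xx' yx']]]] : _ := near (`|i| + `|n0|)%N 4^-1 ltac:(lra).
have {}tsn : n = n0 by apply: uniq; lra.
rewrite tsn in yx'; rewrite yx'; last by lia.
by rewrite /= /shift xx' //; lia.
Qed.

(** Connectedness of an interval turns local constancy of the symbolic
    coordinate in a flow box into constancy. *)
Lemma path_in_flow_box (c : R -> SX) (t0 : R) : continuous c ->
  exists2 e : R, 0 < e & forall t, `|t0 - t| < e -> exists r, c t = flow r (c t0).
Proof.
move=> cc; have [x [s xs]] := torus_ptP (c t0).
(* The part of a flow box of height 1 over the configurations in P. *)
pose V (P : X -> Prop) := [set z : SX | exists y r,
  [/\ z = torus_pt y r, P y & `|s - r| < 2^-1]].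
have oV (P : X -> Prop) i :
    (forall y y' : X, \val y i = \val y' i -> P y -> P y') -> open (V P).
  move=> Pi; rewrite openE => z [y [r [-> Py sr]]]; apply/nbhs_torus_pt.
  exists `|i|%N, (2^-1 - `|s - r|); first by rewrite subr_gt0.
  move=> y' r' yy' rr'; exists y', r'; split => //.
    by apply: Pi Py; exact: yy'.
  by have := ler_distD r s r'; lra.
have V_uniq y r : `|s - r| < 2^-1 -> forall P, V P (torus_pt y r) -> P y.
  move=> sr P [y' [r' [/eq_torus_pt[n [y'E r'E]] Py' sr']]].
  suff n0 : n = 0.
    suff -> : y = y' by [].
    by rewrite y'E n0; apply: val_inj; rewrite /= shift0.
  have : `|n%:~R : R| < 1%:~R.
    move: sr sr'; rewrite r'E !ltr_norml => /andP[? ?] /andP[? ?].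
    by apply/andP; split; lra.
  by rewrite -intr_norm ltr_int; lia.
have s0 : `|s - s| < 2^-1 by rewrite subrr normr0; lra.
have /nbhs_ballP[e /= e0 He] : nbhs t0 (c @^-1` V (fun=> True)).
  apply: (cc t0); rewrite xs; apply: open_nbhs_nbhs; split; first exact: (oV _ 0).
  by exists x, s.
exists e => // t t0t.
have [y [r [cty _ sr]]] := He t t0t; exists (r - s).
suff yx : y = x by rewrite cty yx xs flow_torus_pt addrC subrK.
apply: val_inj; apply/funext => i.
have conB : connected (ball t0 e : set R).
  apply/connected_intervalP => a b + + m.
  rewrite /ball/= !ltr_norml => /andP[? ?] /andP[? ?] /andP[? ?].
  by apply/andP; split; lra.
pose C (P : Prop -> Prop) := c @^-1` V (fun y => P (\val y i = \val x i)).
have oC P : open (C P).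
  by apply: open_comp => [? _|]; [exact: cc|apply: (oV _ i) => v v' ->].
have BE : ball t0 e `&` C id = ball t0 e `&` ~` C not.
  apply/seteqP; split => t' [t0t' Ct']; split => //.
    move=> [y' [r' [cE + sr']]]; apply.
    by apply: (V_uniq _ _ sr' (fun y => \val y i = \val x i)); rewrite -cE.
  have [y' [r' [cE _ sr']]] := He t' t0t'; exists y', r'; split => //.
  by apply: contrapT => ne; apply: Ct'; exists y', r'.
have : (ball t0 e `&` C id) t.
  rewrite (conB (ball t0 e `&` C id)) //.
  - by exists t0; split; [exact: ballxx|exists x, s].
  - by exists (C id).
  - by exists (~` C not); [exact: open_closedC|].
by move=> [_ Ct]; apply: (V_uniq _ _ sr (fun y => \val y i = \val x i)); rewrite -cty.
Qed.

(** Lying in a given orbit is a locally constant condition along a path, although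
    orbits are in general neither open nor closed. *)
Lemma path_in_orbit (c : R -> SX) : continuous c ->
  forall t, exists r, c t = flow r (c 0).
Proof.
move=> cc t.
have flowD (r r' : R) (z : SX) : flow r (flow r' z) = flow (r' + r) z.
  by have [x [u ->]] := torus_ptP z; rewrite !flow_torus_pt addrA.
pose O := [set t | exists r, c t = flow r (c 0)].
have oO P : (P = O \/ P = ~` O) -> open P.
  move=> PO; rewrite openE => t0 Pt0.
  have [e e0 He] := path_in_flow_box t0 cc.
  apply/nbhs_ballP; exists e => //= t1 /He[r cE].
  case: PO Pt0 => -> /=; first by move=> [r' cE']; exists (r' + r); rewrite cE cE' flowD.
  move=> nO [r' cE']; apply: nO; exists (r' - r).
  rewrite -flowD -cE' cE flowD subrr.
  by have [x [u ->]] := torus_ptP (c t0); rewrite flow_torus_pt addr0.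
suff OT : O = setT by have : [set: R] t by []; rewrite -OT.
have conT : connected (@setT R) by apply/connected_intervalP => a b _ _ m _.
apply: conT.
- by exists 0, 0; have [x [u ->]] := torus_ptP (c 0); rewrite flow_torus_pt addr0.
- by exists O; [apply: oO; left|rewrite setTI].
- by exists O; [rewrite -(setCK O); apply: open_closedC; apply: oO; right|rewrite setTI].
Qed.
End mapping_torus_topology.
(** * Sequences indexed by the integers *)

Section int_sequences.

(** Used with values in the integers for positions of markers, and with real
    values for the times at which the image of each unit of time starts. *)
Lemma int_partial_sums (V : zmodType) (f : int -> V) (v : V) :
  exists P : int -> V, P 0 = v /\ forall i, P (i + 1) = P i + f i.
Proof.
pose P (i : int) := match i with
  | Posz n => v + \sum_(k < n) f k%:Z
  | Negz n => v - \sum_(k < n.+1) f (Negz k) end.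
exists P; split; first by rewrite /= big_ord0 addr0.
case=> [n|[|n]].
- by rewrite (_ : n%:Z + 1 = n.+1%:Z) /= ?big_ord_recr /= ?addrA//; lia.
- by rewrite (_ : Negz 0 + 1 = 0)//= big_ord0 big_ord_recr big_ord0 /= add0r addr0 subrK.
- rewrite (_ : Negz n.+1 + 1 = Negz n) /=; last by lia.
  by rewrite [in RHS]big_ord_recr /= opprD addrA subrK.
Qed.

Lemma int_increasing (R : realDomainType) (P : int -> R) :
  (forall i, P i < P (i + 1)) -> forall i j, (P i < P j) = (i < j).
Proof.
move=> Pi; suff lt i j : i < j -> P i < P j.
  move=> i j; apply/idP/idP; last exact: lt.
  by case: (ltgtP i j) => [//|/lt /ltW|->]; rewrite ?ltxx// leNgt => /negbTE ->.
move=> ij; rewrite (_ : j = i + (absz (j - i)%R).-1.+1%:Z); last by lia.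
elim: (_.-1) => [|n ih]; first exact: Pi.
by apply: lt_trans ih _; rewrite (_ : i + n.+2%:Z = i + n.+1%:Z + 1) //; lia.
Qed.

(** A uniform lower bound c on the steps, and not only their positivity, makes the
    sequence unbounded on both sides. *)
Lemma int_locate (R : archiRealFieldType) (c : R) (P : int -> R) : 0 < c ->
  (forall i, P i + c <= P (i + 1)) -> forall y, exists i, P i <= y < P (i + 1).
Proof.
move=> c0 Pc y.
have up i n : P i + n%:R * c <= P (i + n%:Z).
  elim: n => [|n ih]; first by rewrite mul0r !addr0.
  rewrite (_ : i + n.+1%:Z = i + n%:Z + 1); last by lia.
  by apply: le_trans (Pc _); rewrite -natr1 mulrDl mul1r addrA lerD2r.
have arch z : exists n : nat, z < n%:R * c.
  exists (Num.bound `|z / c|); rewrite -ltr_pdivrMr//.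
  by apply: le_lt_trans (ler_norm _) _; rewrite archi_boundP.
have [m mP] := arch (P 0 - y); have := up (- m%:Z) m; rewrite addNr => mP'.
have ex : exists n : nat, y < P (- m%:Z + n%:Z).
  have [n nP] := arch (y - P (- m%:Z)); exists n.
  by apply: lt_le_trans (up _ _); lra.
case: (ex_minnP ex) => -[|n] yn least; first by move: yn; rewrite addr0; lra.
exists (- m%:Z + n%:Z).
rewrite -addrA [n%:Z + 1](_ : _ = n.+1%:Z) ?yn ?andbT; last by lia.
by rewrite leNgt; apply/negP => /least; rewrite ltnn.
Qed.
End int_sequences.
(** * Concatenations of marked blocks *)

Section marked_concatenations.
Variable A : finType.
Implicit Types (w : int -> seq A) (p q : int -> int) (x y : fullshift (option A)).

(** The marker preceding [w i] is at [p i].  As [onth] is [None] past the end of a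
    word and markers are [None], the case k = size (w i) puts the next marker. *)
Definition marked w p x : Prop := forall i : int,
  p (i + 1) = p i + (size (w i)).+1%:Z /\
  forall k, (k <= size (w i))%N -> x (p i + k.+1%:Z) = onth (w i) k.

Section basics.
Variables (w : int -> seq A) (p : int -> int) (x : fullshift (option A)).
Hypothesis mx : marked w p x.

Lemma marked_next i : p (i + 1) = p i + (size (w i)).+1%:Z.
Proof. by case: (mx i). Qed.

Lemma marked_next0 : p 1 = p 0 + (size (w 0)).+1%:Z.
Proof. exact: (marked_next 0). Qed.

Lemma marked_letter i k : (k <= size (w i))%N -> x (p i + k.+1%:Z) = onth (w i) k.
Proof. by case: (mx i) => _; apply. Qed.

Lemma marked_marker i : x (p i) = None.
Proof.
rewrite -[i](subrK 1) marked_next marked_letter// onth_default//.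
Qed.

Lemma marked_lt i j : (p i < p j) = (i < j).
Proof. by apply: int_increasing => k; rewrite marked_next; lia. Qed.

Lemma marked_block m : exists i, p i <= m < p (i + 1).
Proof.
have [|i] := @int_locate rat 1 (fun i => (p i)%:~R) ltr01 _ m%:~R.
  by move=> i; rewrite marked_next -(intrD _ _ 1%Z) ler_int; lia.
by rewrite ler_int ltr_int; exists i.
Qed.

Lemma marked_None m : x m = None -> exists i, p i = m.
Proof.
move=> xm; have [i /andP[im mi]] := marked_block m.
have [->|ne] := eqVneq m (p i); first by exists i.
move: mi xm; rewrite marked_next => mi.
pose k := absz (m - p i - 1)%R.
rewrite (_ : m = p i + k.+1%:Z); last by lia.
rewrite marked_letter; last by lia.
by move=> /eqP; have := onthTE (w i) k; case: onth => //=; lia.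
Qed.

Lemma marked_reindex (j : int) :
  marked (fun i => w (i + j)) (fun i => p (i + j)) x.
Proof. by move=> i; rewrite addrAC; exact: mx. Qed.

Lemma marked_shift (m : int) : marked w (fun i => p i - m) (shift m x).
Proof.
move=> i; split=> [|k ki]; first by rewrite marked_next; lia.
by rewrite /shift -marked_letter//; congr (x _); lia.
Qed.
End basics.

Lemma marked_exists w (m : int) : exists p x, marked w p x /\ p 0 = m.
Proof.
have [p [p0 pS]] := int_partial_sums (fun i => (size (w i)).+1%:Z) m.
have plt : forall i j, (p i < p j) = (i < j).
  by apply: int_increasing => i; rewrite pS; lia.
(* The marker at p (i + 1) is counted with the block that it ends. *)
have loc j : exists i, p i <= j - 1 < p (i + 1).
  have [|i] := @int_locate rat 1 (fun i => (p i)%:~R) ltr01 _ (j - 1)%:~R.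
    by move=> i; rewrite pS -(intrD _ _ 1%Z) ler_int; lia.
  by rewrite ler_int ltr_int; exists i.
pose b j := sval (cid (loc j)).
have bP j : p (b j) <= j - 1 < p (b j + 1) := svalP (cid (loc j)).
pose x : fullshift (option A) := fun j => onth (w (b j)) (absz (j - 1 - p (b j))%R).
exists p, x; split=> // i; split=> [|k ki]; first exact: pS.
have bi : b (p i + k.+1%:Z) = i.
  have := bP (p i + k.+1%:Z); move: (b _) => j; have := pS i => pSi /andP[j1 j2].
  have : j < i + 1 by rewrite -plt pSi; lia.
  by have : i < j + 1 by [rewrite -plt; lia]; lia.
by rewrite /x bi; congr onth; lia.
Qed.

Lemma nth_factor x m n k : (k < n)%N -> nth None (factor x m n) k = x (m + k%:Z).
Proof. by move=> kn; rewrite (nth_map 0%N) ?size_iota// nth_iota. Qed.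

Lemma size_factor (T : choiceType) (y : fullshift T) m n : size (factor y m n) = n.
Proof. by rewrite size_map size_iota. Qed.

Lemma marked_concatP w x : marked_concat w x <-> exists p, marked w p x.
Proof.
split=> -[p px]; exists p => i; have [pi fi] := px i; split => //.
  have xk j k : (k <= size (w j))%N ->
      x (p j + k%:Z) = nth None (None :: [seq Some a | a <- w j]) k.
    by move=> kj; have [_ <-] := px j; rewrite nth_factor.
  move=> k; rewrite leq_eqVlt => /orP[/eqP ->|ki].
    by rewrite -pi -[p (i + 1)]addr0 (xk _ 0%N)// onth_default.
  by rewrite (xk i k.+1) /=; [rewrite onthE|lia].
apply: (@eq_from_nth _ None); rewrite size_factor /= ?size_map// => k ki.
rewrite nth_factor//; case: k ki => [|k] ki /=.
  by rewrite addr0; exact: (marked_marker px).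
by rewrite fi; [exact: onthE|lia].
Qed.

(** The end of the shorter word is visible, as [onth] is [None] there, and forces
    the other word to end at the same place. *)
Lemma eq_onth_lt (T : Type) (s s' : seq T) (m : nat) :
  (forall k, (k < m)%N -> onth s k = onth s' k) ->
  (size s < m)%N || (size s' < m)%N -> s = s'.
Proof.
wlog ss' : s s' / (size s <= size s')%N => [H sk|sk].
  have [/H|/ltnW/H] := leqP (size s) (size s'); first exact.
  by rewrite orbC => H' /H' -> // k /sk.
move=> sm.
have {}ss' : size s = size s'.
  have := sk (size s) ltac:(lia); rewrite onth_default// => e.
  by have := onthNE s' (size s); rewrite -e /=; lia.
apply: eq_from_onth => k; have [km|km] := ltnP k m; first exact: sk.
by rewrite !onth_default//; lia.
Qed.

Lemma marked_eq_block w p x w' p' x' i i' :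
  marked w p x -> marked w' p' x' ->
  forall m, (forall k, (k <= m)%N -> x (p i + k%:Z) = x' (p' i' + k%:Z)) ->
  (size (w i) < m)%N || (size (w' i') < m)%N -> w i = w' i'.
Proof.
move=> mx mx' m xx' sm.
apply: (@eq_onth_lt _ _ _ (minn m (minn (size (w i)) (size (w' i'))).+1)); last by lia.
move=> k km; rewrite -(marked_letter mx); last by lia.
by rewrite -(marked_letter mx') ?xx'//; lia.
Qed.

Lemma marked_eq_block_left w p x w' p' x' i i' :
  marked w p x -> marked w' p' x' ->
  forall m, (forall k, (k <= m)%N -> x (p (i + 1) - k%:Z) = x' (p' (i' + 1) - k%:Z)) ->
  (size (w i) < m)%N || (size (w' i') < m)%N -> w i = w' i'.
Proof.
move=> mx mx' m xx' sm.
have mn := marked_next mx i; have mn' := marked_next mx' i'.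
have back w1 p1 x1 i1 (mx1 : marked w1 p1 x1) k : (k < size (w1 i1))%N ->
    x1 (p1 (i1 + 1) - k.+1%:Z) <> None.
  move=> ki; rewrite (_ : _ - _ = p1 i1 + (size (w1 i1) - k.+1).+1%:Z); last first.
    by rewrite (marked_next mx1); lia.
  rewrite (marked_letter mx1); last by lia.
  by have := onthTE (w1 i1) (size (w1 i1) - k.+1); case: onth => //=; lia.
suff sE : size (w i) = size (w' i').
  apply: (marked_eq_block mx mx' (m := (size (w i)).+1)) => [k km|]; last by lia.
  have := xx' ((size (w i)).+1 - k)%N ltac:(lia).
  by rewrite (_ : p (i + 1) - _ = p i + k) 1?(_ : p' (i' + 1) - _ = p' i' + k) //; lia.
have [ss|ss|//] := ltngtP (size (w i)) (size (w' i')).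
  have /esym := xx' (size (w i)).+1 ltac:(lia).
  rewrite [X in x X](_ : _ = p i) ?(marked_marker mx); last by lia.
  by move/(back _ _ _ _ mx' _ ss).
have := xx' (size (w' i')).+1 ltac:(lia).
rewrite [X in x' X](_ : _ = p' i') ?(marked_marker mx'); last by lia.
by move/(back _ _ _ _ mx _ ss).
Qed.
End marked_concatenations.
(** * Approximation of a marker shift by concatenations *)

Section marker_shift_theory.
Variables (A : finType) (L : set (seq A)).
Local Notation X := (marker_shift L).

Lemma factor_shift (S : choiceType) (x : fullshift S) n i m :
  factor (shift n x) i m = factor x (i + n) m.
Proof. by rewrite /factor /shift; apply: eq_map => k; rewrite addrAC. Qed.

Lemma eq_factor (S : choiceType) (x y : fullshift S) i n :
  (forall k, (k < n)%N -> x (i + k%:Z) = y (i + k%:Z)) ->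
  factor x i n = factor y i n.
Proof. by move=> xy; apply/eq_in_map => k; rewrite mem_iota => /xy. Qed.

Lemma marker_shift_shift n x : X x -> X (shift n x).
Proof.
have [F ->] := marker_shift_subshift L.
by move=> /= Fx i w Fw; rewrite factor_shift; exact: Fx.
Qed.

(** A subshift is defined by its finite factors, so it is closed. *)
Lemma marker_shift_closed x :
  (forall N, exists2 x' : fullshift (option A), X x' & agree N x x') -> X x.
Proof.
have [F ->] := marker_shift_subshift L.
move=> /= cl i w Fw; have [x' Fx' xx'] := cl (absz i + size w)%N.
rewrite (@eq_factor _ x x') => [|k kw]; first exact: Fx'.
by apply: xx'; lia.
Qed.

Lemma marker_shift_marked w p x :
  (forall i, L (w i)) -> marked w p x -> X x.
Proof.
move=> Lw mx; apply: sub_gen_smallest; exists w => //.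
by apply/marked_concatP; exists p.
Qed.

(** The configurations all of whose factors occur in concatenations of marked
    blocks form a subshift, so the smallest one has no others. *)
Lemma marker_shift_approx (x : fullshift (option A)) N : X x ->
  exists w p x', [/\ forall i, L (w i), marked w p x' & agree N x x'].
Proof.
pose occurs (u : seq (option A)) := exists w p x' i,
  [/\ forall j, L (w j), marked w p x' & factor x' i (size u) = u].
move=> Xx.
have /= Fx : [set x | forall i u, ~ occurs u -> factor x i (size u) <> u] x.
  apply: Xx; split; first by exists [set u | ~ occurs u].
  move=> y [w Lw /marked_concatP[p mp]] i u nu yu.
  by apply: nu; exists w, p, y, i.
have /contrapT[w [p [x' [i [Lw mx' fE]]]]] : ~ ~ occurs (factor x (- N%:Z) (N + N).+1).
  by move=> /(Fx (- N%:Z)); rewrite size_factor.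
exists w, (fun j => p j - (i + N%:Z)), (shift (i + N%:Z) x'); split => //.
  exact: marked_shift.
move=> j jN; move: fE; rewrite size_factor => fE.
have := nth_factor x' i (n := (N + N).+1) (k := absz (j + N%:Z)%R) ltac:(lia).
rewrite fE nth_factor; last by lia.
rewrite /shift => e; rewrite (_ : j + (i + N%:Z) = i + absz (j + N%:Z)%R); last by lia.
by rewrite -e; congr (x _); lia.
Qed.
End marker_shift_theory.

Lemma onth_take_lt (T : Type) (s : seq T) n k : (k < n)%N ->
  onth (take n s) k = onth s k.
Proof. by move=> kn; rewrite !onthE map_take nth_take. Qed.

Lemma onth_drop (T : Type) (s : seq T) n k : onth (drop n s) k = onth s (n + k).
Proof. by rewrite !onthE map_drop nth_drop. Qed.

(** * Locality of prefix rewriting *)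

Section first_markers.
Variable A : finType.
Implicit Types (w : int -> seq A) (p : int -> int) (x : fullshift (option A)).

(** A marker that is visible in both configurations separates the origin from
    everything before it in both. *)
Lemma marked_last_le w1 p1 x1 w2 p2 x2 K :
  marked w1 p1 x1 -> marked w2 p2 x2 -> p1 0 <= 0 < p1 1 -> p2 0 <= 0 < p2 1 ->
  agree K x1 x2 -> - K%:Z <= p1 0 -> p1 0 <= p2 0.
Proof.
move=> m1 m2 h1 h2 xx K1.
have : x2 (p1 0) = None by rewrite -xx ?(marked_marker m1)//; lia.
move=> /(marked_None m2)[j jE]; rewrite -jE leNgt (marked_lt m2) -leNgt.
suff : j < 1 by lia.
by rewrite -(marked_lt m2) jE; case/andP: h2 => _; apply: le_lt_trans; lia.
Qed.

Lemma marked_next_le w1 p1 x1 w2 p2 x2 K :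
  marked w1 p1 x1 -> marked w2 p2 x2 -> p1 0 <= 0 < p1 1 -> p2 0 <= 0 < p2 1 ->
  agree K x1 x2 -> p1 1 <= K%:Z -> p2 1 <= p1 1.
Proof.
move=> m1 m2 h1 h2 xx K1.
have : x2 (p1 1) = None by rewrite -xx ?(marked_marker m1)//; lia.
move=> /(marked_None m2)[j jE]; rewrite -jE leNgt (marked_lt m2) -leNgt.
suff : 0 < j by lia.
by rewrite -(marked_lt m2) jE; case/andP: h2 => + _ => /le_lt_trans; apply; lia.
Qed.

Lemma marked_visible_left w1 p1 x1 w2 p2 x2 K :
  marked w1 p1 x1 -> marked w2 p2 x2 -> p1 0 <= 0 < p1 1 -> p2 0 <= 0 < p2 1 ->
  agree K x1 x2 -> - K%:Z <= p1 0 -> p2 0 = p1 0.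
Proof.
move=> m1 m2 h1 h2 xx K1; have le := marked_last_le m1 m2 h1 h2 xx K1.
have := marked_last_le m2 m1 h2 h1 (agree_sym xx) ltac:(lia); lia.
Qed.

Lemma marked_visible_right w1 p1 x1 w2 p2 x2 K :
  marked w1 p1 x1 -> marked w2 p2 x2 -> p1 0 <= 0 < p1 1 -> p2 0 <= 0 < p2 1 ->
  agree K x1 x2 -> p1 1 <= K%:Z -> p2 1 = p1 1.
Proof.
move=> m1 m2 h1 h2 xx K1; have le := marked_next_le m1 m2 h1 h2 xx K1.
have := marked_next_le m2 m1 h2 h1 (agree_sym xx) ltac:(lia); lia.
Qed.

End first_markers.

(** A self-map of a language that only rewrites a prefix of bounded length.  The
    bound [C] on the change of length also covers the words shorter than n, on
    which the map is arbitrary. *)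
Record prefix_rewriting (A : finType) (L : set (seq A)) (f : seq A -> seq A)
    (n C : nat) (pre : seq A -> seq A) : Prop := PrefixRewriting {
  rewriting_stable : forall w, L w -> L (f w);
  rewriting_prefix : forall w, L w -> (n <= size w)%N ->
    f w = pre (take n w) ++ drop n w;
  rewriting_size_le : forall w, L w -> (size (f w) <= size w + C)%N;
  rewriting_size_ge : forall w, L w -> (size w <= size (f w) + C)%N }.

Section locality.
Variables (A : finType) (L : set (seq A)) (f : seq A -> seq A) (n C : nat).
Variable pre : seq A -> seq A.
Hypothesis fP : prefix_rewriting L f n C pre.

(** How far to look from a marker to know N symbols of the image: a block of the
    image with its marker, of length b, comes from one of length at most
    C.+1 * b, and n more symbols determine the rewriting of a block whose end is
    not seen. *)
Definition preimage_length (N : nat) : nat := (C.+1 * N + n).+1.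

(** When the right ends of a block and of its image are aligned, the two only
    differ near the left end. *)
Lemma rewriting_tail w p q x y i k :
  (forall i, L (w i)) -> marked w p x -> marked (f \o w) q y ->
  (k + n <= size (w i))%N -> y (q (i + 1) - k%:Z) = x (p (i + 1) - k%:Z).
Proof.
move=> Lw mx my; case: k => [|k] kn.
  by rewrite !subr0 (marked_marker mx) (marked_marker my).
have fE := rewriting_prefix fP (Lw i) ltac:(lia).
have sfE := congr1 size fE; rewrite size_cat size_drop in sfE.
rewrite (marked_next mx) (marked_next my) /=.
rewrite (_ : q i + _ - _ = q i + (size (f (w i)) - k.+1).+1%:Z); last by lia.
rewrite (_ : p i + _ - _ = p i + (size (w i) - k.+1).+1%:Z); last by lia.
rewrite (marked_letter my) /=; last by lia.
rewrite (marked_letter mx) /=; last by lia.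
rewrite {1}fE onth_cat ltnNge.
have -> : (size (pre (take n (w i))) <= size (f (w i)) - k.+1)%N by lia.
by rewrite onth_drop; congr onth; lia.
Qed.

Variables (w w' : int -> seq A) (p p' q q' : int -> int).
Variables (x x' y y' : fullshift (option A)).
Hypotheses (Lw : forall i, L (w i)) (Lw' : forall i, L (w' i)).
Hypotheses (mx : marked w p x) (mx' : marked w' p' x').
Hypotheses (my : marked (f \o w) q y) (my' : marked (f \o w') q' y').

Lemma preimage_length_ge N v : L v -> ((size (f v)).+1 <= N)%N ->
  ((size v).+1 + preimage_length (N - (size (f v)).+1) <= preimage_length N)%N.
Proof. by move=> /(rewriting_size_ge fP) vC fvN; rewrite /preimage_length; nia. Qed.

(** Induction over the blocks: if the current block ends within sight, it is the
    same in both configurations and the argument continues after it.  Otherwise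
    both blocks are long and have the same first n letters, so their prefixes
    are rewritten in the same way. *)
Lemma locality_right N i i' :
  (forall k, (k <= preimage_length N)%N -> x (p i + k%:Z) = x' (p' i' + k%:Z)) ->
  forall k, (k <= N)%N -> y (q i + k%:Z) = y' (q' i' + k%:Z).
Proof.
have [m] := ubnP N; elim: m N i i' => // m ih N i i' Nm xx' k kN.
have [sm|lg] := boolP ((size (w i) < preimage_length N) || (size (w' i') < preimage_length N))%N.
  have ww' : w i = w' i' by exact: (marked_eq_block mx mx' xx' sm).
  case: k kN => [|k] kN.
    by rewrite !addr0 (marked_marker my) (marked_marker my').
  have [kw|kw] := leqP k (size (f (w i))).
    by rewrite (marked_letter my)// (marked_letter my')/= -?ww'.
  set b := size (f (w i)) in kw *.
  have := ih (N - b.+1)%N (i + 1) (i' + 1) ltac:(lia) _ (k - b)%N ltac:(lia).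
  rewrite (marked_next my) (marked_next my') /= -ww' -/b => e.
  rewrite (_ : q i + k.+1%:Z = q i + b.+1%:Z + (k - b)%N%:Z); last by lia.
  rewrite (_ : q' i' + k.+1%:Z = q' i' + b.+1%:Z + (k - b)%N%:Z); last by lia.
  apply: e => j jN.
  rewrite (marked_next mx) (marked_next mx') /= -ww' -!addrA -!PoszD.
  apply: xx'.
  have := @preimage_length_ge N (w i) (Lw i); rewrite -/b => /(_ ltac:(lia)) h; lia.
move: lg; rewrite negb_or -!leqNgt => /andP[lg lg'].
have tk : take n (w i) = take n (w' i').
  apply: eq_from_onth => j; have [jn|jn] := ltnP j n; last first.
    by rewrite !onth_default// size_take_min; lia.
  rewrite !onth_take_lt//.
  rewrite -(marked_letter mx); last by rewrite /preimage_length in lg lg'; lia.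
  rewrite -(marked_letter mx'); last by rewrite /preimage_length in lg lg'; lia.
  by apply: xx'; rewrite /preimage_length in lg lg' *; lia.
have nN : (n + N < preimage_length N)%N by rewrite /preimage_length; nia.
have fE := rewriting_prefix fP (Lw i) ltac:(lia).
have fE' := rewriting_prefix fP (Lw' i') ltac:(lia).
case: k kN => [|k] kN.
  by rewrite !addr0 (marked_marker my) (marked_marker my').
rewrite (marked_letter my) /=; last by rewrite fE size_cat size_drop; lia.
rewrite (marked_letter my') /=; last by rewrite fE' size_cat size_drop; lia.
rewrite fE fE' tk !onth_cat; case: ltnP => // kp.
rewrite !onth_drop -(marked_letter mx); last by lia.
by rewrite -(marked_letter mx') ?xx'//; lia.
Qed.

(** As in [locality_right], but a block that starts out of sight is known by the
    end that the rewriting leaves unchanged. *)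
Lemma locality_left N i i' :
  (forall k, (k <= preimage_length N)%N -> x (p (i + 1) - k%:Z) = x' (p' (i' + 1) - k%:Z)) ->
  forall k, (k <= N)%N -> y (q (i + 1) - k%:Z) = y' (q' (i' + 1) - k%:Z).
Proof.
have [m] := ubnP N; elim: m N i i' => // m ih N i i' Nm xx' k kN.
have [sm|lg] := boolP ((size (w i) < preimage_length N) || (size (w' i') < preimage_length N))%N.
  have ww' : w i = w' i' by exact: (marked_eq_block_left mx mx' xx' sm).
  have qE := marked_next my i; have qE' := marked_next my' i'.
  have pE := marked_next mx i; have pE' := marked_next mx' i'.
  rewrite /= -ww' in qE qE' pE'.
  have [kw|kw] := leqP k (size (f (w i))).
    rewrite qE qE'.
    rewrite (_ : q i + _ - _ = q i + (size (f (w i)) - k).+1%:Z); last by lia.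
    rewrite (_ : q' i' + _ - _ = q' i' + (size (f (w i)) - k).+1%:Z); last by lia.
    by rewrite (marked_letter my)/= ?(marked_letter my')/= -?ww'//; lia.
  set b := size (f (w i)) in kw qE qE' *.
  have := ih (N - b.+1)%N (i - 1) (i' - 1) ltac:(lia) _ (k - b.+1)%N ltac:(lia).
  rewrite !subrK => e.
  rewrite (_ : q (i + 1) - k%:Z = q i - (k - b.+1)%N%:Z); last by lia.
  rewrite (_ : q' (i' + 1) - k%:Z = q' i' - (k - b.+1)%N%:Z); last by lia.
  apply: e => j jN.
  have jw : ((size (w i)).+1 + j <= preimage_length N)%N.
    by have := @preimage_length_ge N (w i) (Lw i); rewrite -/b => /(_ ltac:(lia)) h; lia.
  have := xx' _ jw.
  rewrite (_ : p (i + 1) - _ = p i - j%:Z); last by lia.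
  by rewrite (_ : p' (i' + 1) - _ = p' i' - j%:Z); last by lia.
move: lg; rewrite negb_or -!leqNgt => /andP[lg lg'].
have nN : (n + N < preimage_length N)%N by rewrite /preimage_length; nia.
rewrite (rewriting_tail Lw mx my); last by lia.
rewrite (rewriting_tail Lw' mx' my'); last by lia.
by apply: xx'; lia.
Qed.

Hypotheses (p0 : p 0 <= 0 < p 1) (p0' : p' 0 <= 0 < p' 1).

Definition growth v : int := (size (f v))%:Z - (size v)%:Z.

(** If the marker before the origin is visible, then so is either the whole block
    that follows it or the prefix that is rewritten. *)
Lemma visible_growth K : (n <= K)%N -> agree K x x' -> - K%:Z <= p 0 ->
  p' 0 = p 0 /\ growth (w' 0) = growth (w 0).
Proof.
move=> nK xx' Kp; have pp := marked_visible_left mx mx' p0 p0' xx' Kp.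
split=> //; have ps := marked_next0 mx; have ps' := marked_next0 mx'.
have [p1K|p1K] := lerP (p 1) K%:Z.
  have pp1 := marked_visible_right mx mx' p0 p0' xx' p1K.
  suff -> : w 0 = w' 0 by [].
  apply: (marked_eq_block mx mx' (m := (size (w 0)).+1)) => [k km|]; last by lia.
  by rewrite pp; apply: xx'; lia.
have p1K' : K%:Z < p' 1.
  rewrite ltNge; apply/negP => h.
  have := marked_visible_right mx' mx p0' p0 (agree_sym xx') h; lia.
have tk : take n (w 0) = take n (w' 0).
  apply: eq_from_onth => j; have [jn|jn] := ltnP j n; last first.
    by rewrite !onth_default// size_take_min; lia.
  rewrite !onth_take_lt// -(marked_letter mx); last by lia.
  rewrite -(marked_letter mx'); last by lia.
  by rewrite pp; apply: xx'; lia.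
rewrite /growth (rewriting_prefix fP (Lw 0)); last by lia.
rewrite (rewriting_prefix fP (Lw' 0)); last by lia.
by rewrite tk !size_cat !size_drop; lia.
Qed.

(** The marker before the origin is at distance at most N + n + 1 or irrelevant;
    in the first case its image is at distance at most N + n + 1 + C, and the
    image has to be known up to N + N + n + C + 1 symbols away from it. *)
Definition window (N : nat) : nat := (preimage_length (N + N + n + C).+1 + N + n).+1.

(** With the marker following the origin kept in place (q 1 = p 1), a rewritten
    prefix far to the left of the origin does not move the symbols near the
    origin.  If the marker before the origin is far, the image is that of the
    source up to the next marker, and [locality_right] applies from there on;
    otherwise both sides are computed from the marker before the origin. *)
Lemma locality N : q 1 = p 1 -> q' 1 = p' 1 ->
  agree (window N) x x' -> agree N y y'.
Proof.
move=> qp qp' xx' j jN.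
have ps := marked_next0 mx; have ps' := marked_next0 mx'.
have qs := marked_next0 my; have qs' := marked_next0 my'.
rewrite /= in qs qs'.
have sl := rewriting_size_le fP (Lw 0); have sg := rewriting_size_ge fP (Lw 0).
have [near|far] := lerP (- (N + n).+1%:Z) (p 0).
  have xK : agree (N + n).+1 x x' by apply: agreeW xx'; rewrite /window; lia.
  have [pE gE] := visible_growth (K := (N + n).+1) ltac:(lia) xK near.
  have qE : q' 0 = q 0 by rewrite /growth in gE; lia.
  set M := (N + N + n + C).+1.
  have [j0|j0] := lerP (q 0) j.
    pose k0 := absz (j - q 0)%R; rewrite (_ : j = q 0 + k0%:Z); last by lia.
    rewrite -{2}qE; apply: (locality_right (N := M)) => [k kM|]; last by lia.
    by rewrite pE; apply: xx'; rewrite /window -/M; lia.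
  pose k0 := absz (q 0 - j)%R; rewrite (_ : j = q 0 - k0%:Z); last by lia.
  rewrite -{2}qE -[0](addNr 1); apply: (locality_left (N := M)) => [k kM|]; last by lia.
  have e0 : (absz (p 0 - k%:Z)%R <= window N)%N by rewrite /window -/M; lia.
  by rewrite addNr pE; exact: xx' e0.
have far' : p' 0 < - (N + n).+1%:Z.
  rewrite ltNge; apply/negP => h.
  have xK : agree (N + n).+1 x' x by apply: agreeW (agree_sym xx'); rewrite /window; lia.
  have := marked_visible_left mx' mx p0' p0 xK h; lia.
have same : j <= p 1 -> j <= p' 1 -> y j = y' j.
  move=> j1 j1'.
  have := rewriting_tail (i := 0) (k := absz (p 1 - j)%R) Lw mx my ltac:(lia).
  have := rewriting_tail (i := 0) (k := absz (p' 1 - j)%R) Lw' mx' my' ltac:(lia).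
  rewrite !add0r qp qp' (_ : p' 1 - _ = j); last by lia.
  rewrite (_ : p 1 - _ = j); last by lia.
  by move=> -> ->; apply: xx'; rewrite /window; lia.
have [vis|hid] := lerP (p 1) N%:Z.
  have pE := marked_visible_right mx mx' p0 p0' xx' ltac:(rewrite /window; lia).
  have [jp|jp] := lerP j (p 1); first by apply: same; lia.
  pose k0 := absz (j - p 1)%R; rewrite (_ : j = q 1 + k0%:Z); last by lia.
  rewrite {2}(_ : q 1 = q' 1); last by lia.
  apply: (locality_right (N := N)) => [k kM|]; last by lia.
  by rewrite pE; apply: xx'; move: kM; rewrite /window /preimage_length; nia.
apply: same; first by lia.
have : N%:Z < p' 1; last by lia.
rewrite ltNge; apply/negP => h.
have xK : agree N x' x by apply: agreeW (agree_sym xx'); rewrite /window; lia.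
have := marked_visible_right mx' mx p0' p0 xK h; lia.
Qed.
End locality.
(** * Homeomorphisms of a half-line that absorb a change of length *)

Section slide.
Variable R : realFieldType.
Implicit Types (d s t k : R).

(** On [0, oo[, the letters, [depth] is - t.  The interval ]-1, 0] of the marker
    is stretched to [0, oo[, which gives room for a block of any length. *)
Definition depth t : R := if 0 <= t then - t else (1 + t)^-1 - 1.
Definition undepth k : R := if k <= 0 then - k else (1 + k)^-1 - 1.
(** The value at -1 is the limit of the other values, so that markers are mapped
    to markers. *)
Definition slide d t : R := if t <= -1 then -1 else undepth (depth t - d).

Lemma undepth_gt k : -1 < undepth k.
Proof.
rewrite /undepth; case: ifPn => [|]; first by lra.
by rewrite -ltNge => k0; have : 0 < (1 + k)^-1 by [rewrite invr_gt0; lra]; lra.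
Qed.

Lemma inv_gt1 t : -1 < t -> t < 0 -> 1 < (1 + t)^-1.
Proof. by move=> t1 t0; rewrite invf_gt1; lra. Qed.

Lemma inv_lt1 k : 0 < k -> (1 + k)^-1 < 1.
Proof. by move=> k0; rewrite invf_lt1; lra. Qed.

Lemma depthK t : -1 < t -> undepth (depth t) = t.
Proof.
rewrite /depth; case: (lerP 0 t) => t0 t1; rewrite /undepth.
  by case: ifPn => [_|]; [lra|rewrite -ltNge; lra].
have := inv_gt1 t1 t0 => i1; rewrite leNgt (_ : 0 < _) /=; last by lra.
by rewrite [1 + (_ - 1)]addrC subrK invrK; lra.
Qed.

Lemma undepthK k : depth (undepth k) = k.
Proof.
rewrite /undepth; case: (lerP k 0) => k0; rewrite /depth.
  by case: ifPn => [_|]; [lra|rewrite -ltNge; lra].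
have := inv_lt1 k0 => i1; rewrite leNgt (_ : _ < 0) /=; last by lra.
by rewrite [1 + (_ - 1)]addrC subrK invrK; lra.
Qed.

Lemma undepth_lt k1 k2 : k1 < k2 -> undepth k2 < undepth k1.
Proof.
move=> kk; rewrite /undepth; case: (lerP k2 0) => k20; case: (lerP k1 0) => k10.
- by lra.
- by lra.
- by have := inv_lt1 k20; lra.
- by rewrite ltrD2r ltf_pV2 ?posrE; lra.
Qed.

Lemma depth_lt s t : -1 < s -> s < t -> depth t < depth s.
Proof.
move=> s1 st; rewrite ltNge le_eqVlt; apply/negP => /orP[/eqP e|/undepth_lt].
  have := congr1 undepth e; rewrite !depthK; lra.
by rewrite !depthK; lra.
Qed.

Lemma slide_bound d t : -1 <= slide d t.
Proof. by rewrite /slide; case: ifPn => // _; rewrite ltW// undepth_gt. Qed.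

Lemma slide_bot d : slide d (-1) = -1.
Proof. by rewrite /slide lexx. Qed.

Lemma slideE d t : -1 < t -> slide d t = undepth (depth t - d).
Proof. by rewrite /slide leNgt => ->. Qed.

Lemma slide0 t : -1 <= t -> slide 0 t = t.
Proof.
rewrite le_eqVlt => /orP[/eqP <-|t1]; first exact: slide_bot.
by rewrite slideE// subr0 depthK.
Qed.

Lemma slideD d e t : slide d (slide e t) = slide (d + e) t.
Proof.
have [t1|t1] := lerP t (-1); first by rewrite {2 3}/slide t1 slide_bot.
rewrite (slideE e)// (slideE (d + e))// slideE ?undepth_gt// undepthK.
by congr undepth; lra.
Qed.

Lemma slide_lt d s t : -1 <= s -> s < t -> slide d s < slide d t.
Proof.
rewrite le_eqVlt => /orP[/eqP <- t1|s1 st].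
  by rewrite slide_bot slideE// undepth_gt.
by rewrite !slideE; [apply: undepth_lt; rewrite ltrD2r; exact: depth_lt|lra|lra].
Qed.

Lemma slide_le d s t : -1 <= s -> s <= t -> slide d s <= slide d t.
Proof. by move=> s1; rewrite le_eqVlt => /orP[/eqP -> //|/(slide_lt d s1)/ltW]. Qed.

Lemma slide_translation d t : 0 <= t -> 0 <= t + d -> slide d t = t + d.
Proof.
move=> t0 td; rewrite slideE; last by lra.
by rewrite /depth t0 /undepth; case: ifPn => [_|]; [lra|rewrite -ltNge; lra].
Qed.

(** Between integer times, as d is an integer, only steps whose image lies in the
    marker are shorter than 1, and with d >= - C at most C letters are squeezed
    into it. *)
Lemma slide_step (C a : nat) (d : int) : - C%:Z <= d ->
  (C.+1 * C.+2)%:R^-1 <= slide d%:~R a%:R - slide d%:~R (a%:R - 1).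
Proof.
move=> dC; have CR : - C%:R <= d%:~R :> R by rewrite -[_%:R]/(C%:Z%:~R) -intrN ler_int.
have C0 : 0 <= C%:R :> R by exact: ler0n.
have cE : (C.+1 * C.+2)%:R = (C%:R + 1) * (C%:R + 2) :> R.
  by rewrite natrM -natr1 -[in X in _ * X]natr1 -natr1; ring.
have c1 : (C.+1 * C.+2)%:R^-1 <= 1 :> R by rewrite invf_le1 ?ler1n ?ltr0n.
move: cE c1; move: (C.+1 * C.+2)%:R => c cE c1.
case: a => [|a].
  rewrite sub0r slide_bot opprK slideE ?ltrN10// /depth lexx oppr0 sub0r.
  rewrite /undepth; case: ifPn => [d0|]; first by lra.
  rewrite -ltNge subrK => d0; rewrite lef_pV2 ?posrE ?cE; nra.
have aE : a.+1%:R - 1 = a%:R :> R by rewrite -natr1 addrK.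
have a0 : 0 <= a%:R :> R by exact: ler0n.
have a0' : 0 <= a.+1%:R :> R by exact: ler0n.
rewrite aE !slideE /depth ?a0 ?a0'; [|lra|lra].
rewrite /undepth.
have [h1|h1] := lerP (- a%:R - d%:~R : R) 0.
  have h2 : - a.+1%:R - d%:~R <= 0 :> R by lra.
  by rewrite h2; lra.
have ad : 0 < - a%:Z - d.
  by rewrite -(ltr_int R) intrD !intrN.
have ad1 : 1 <= - a%:R - d%:~R :> R.
  by rewrite -[1]/(1%:~R) -[a%:R]/(a%:Z%:~R) -!intrN -intrD ler_int; lia.
(* The step is 1 / k - 1 / (1 + k) with 1 <= k <= C. *)
set k := - a%:R - d%:~R in h1 ad1 *.
have -> : - a.+1%:R - d%:~R = k - 1 :> R by rewrite /k -aE; lra.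
have kC : k <= C%:R by rewrite /k; lra.
have -> : (if k - 1 <= 0 then - (k - 1) else (1 + (k - 1))^-1 - 1) = k^-1 - 1.
  case: ifPn => [h|_]; last by congr (_^-1 - 1); lra.
  by have -> : k = 1; [lra|rewrite invr1; lra].
have -> : k^-1 - 1 - ((1 + k)^-1 - 1) = (k * (1 + k))^-1.
  by field; apply/andP; split; rewrite gt_eqF; lra.
by rewrite lef_pV2 ?posrE ?cE; nra.
Qed.
End slide.
(** * Images of concatenations and of their limits *)

Section images.
Variables (R : realType) (A : finType) (L : set (seq A)).
Variables (f : seq A -> seq A) (n C : nat) (pre : seq A -> seq A).
Hypothesis fP : prefix_rewriting L f n C pre.
Local Notation X := (marker_shift L).
Local Notation window := (window n C).
Implicit Types (x y : fullshift (option A)) (theta : R -> R).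

(** Time t in [0, 1], in a block with marker at p0 <= 0, is mapped into a block
    that ends at the same place, has d more letters, and hence has its marker at
    p0 - d. *)
Definition block_time (p0 d : int) (t : R) : R :=
  slide d%:~R (t - p0%:~R - 1) + p0%:~R + 1 - d%:~R.

(** [y] with times [theta] is the image of [x] with times in [0, 1], aligned at
    the first marker after the origin. *)
Definition is_image x y theta := exists w p q,
  [/\ forall i, L (w i), marked w p x /\ p 0 <= 0 < p 1,
      marked (f \o w) q y /\ q 1 = p 1 &
      theta = block_time (p 0) (growth f (w 0))].

Lemma growth_bounds v : L v -> - C%:Z <= growth f v <= C%:Z.
Proof.
move=> Lv; have := rewriting_size_le fP Lv; have := rewriting_size_ge fP Lv.
by rewrite /growth; lia.
Qed.

(** Any position k of a block can be taken as the origin; the image of the shifted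
    configuration is a shift of the same image. *)
Lemma is_image_block w p x q y (i k : int) :
  (forall i, L (w i)) -> marked w p x -> marked (f \o w) q y ->
  p i <= k < p (i + 1) ->
  is_image (shift k x) (shift (q (i + 1) - p (i + 1) + k) y)
    (block_time (p i - k) (growth f (w i))).
Proof.
move=> Lw mx my ik.
exists (fun j => w (j + i)), (fun j => p (j + i) - k),
  (fun j => q (j + i) - (q (i + 1) - p (i + 1) + k)); split => //.
- split; first exact/marked_shift/marked_reindex.
  by rewrite /= add0r (addrC 1); move: ik; move: (p (i + 1)) (p i) => *; lia.
- split; last by rewrite /= (addrC 1); move: (p (i + 1)) (q (i + 1)) => *; lia.
  exact: (marked_shift (marked_reindex my i)).
- by rewrite add0r.
Qed.

Lemma is_image_exists w p x :
  (forall i, L (w i)) -> marked w p x -> exists y theta, is_image x y theta.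
Proof.
move=> Lw mx; have [q [y [my _]]] := marked_exists (f \o w) 0.
have [i i0] := marked_block mx 0.
by have := is_image_block Lw mx my i0; rewrite shift0; do 2 eexists; eassumption.
Qed.

Lemma is_image_marked x y theta : is_image x y theta ->
  exists w q, (forall i, L (w i)) /\ marked w q y.
Proof.
move=> [w [p [q [Lw _ [my _] _]]]]; exists (f \o w), q; split => // i.
exact: (rewriting_stable fP).
Qed.

(** Far from the marker, all trace of the change of length d is lost.  This is what
    makes a limit exist on blocks that extend infinitely to the left. *)
Lemma block_time_far (p0 d : int) (t : R) : p0 <= - C.+1%:Z -> - C%:Z <= d -> 0 <= t ->
  block_time p0 d t = t.
Proof.
move=> p0C dC t0.
have h1 : p0%:~R <= - (C%:R + 1) :> R.
  by rewrite natr1 -[_%:R]/(C.+1%:Z%:~R) -intrN ler_int.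
have h2 : - C%:R <= d%:~R :> R by rewrite -[_%:R]/(C%:Z%:~R) -intrN ler_int.
have C0 : 0 <= C%:R :> R by exact: ler0n.
by rewrite /block_time slide_translation; lra.
Qed.

(** In particular the image does not depend on how the configuration is cut
    into blocks. *)
Lemma is_image_local N x y theta x' y' theta' :
  is_image x y theta -> is_image x' y' theta' -> agree (window N) x x' ->
  agree N y y' /\ forall t : R, 0 <= t -> theta t = theta' t.
Proof.
move=> [w [p [q [Lw [mx p0] [my q1] ->]]]] [w' [p' [q' [Lw' [mx' p0'] [my' q1'] ->]]]].
move=> xx'; split; first exact: (locality fP Lw Lw' mx mx' my my' p0 p0').
pose K := (n + C).+1.
have KW : (K <= window N)%N by rewrite /K /window /preimage_length; nia.
have xK := agreeW KW xx'.
have [near|far] := lerP (- K%:Z) (p 0).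
  have nK : (n <= K)%N by rewrite /K; lia.
  by have [-> ->] := visible_growth fP Lw Lw' mx mx' p0 p0' nK xK near.
have far' : p' 0 < - K%:Z.
  rewrite ltNge; apply/negP => h.
  have := marked_visible_left mx' mx p0' p0 (agree_sym xK) h; lia.
have := growth_bounds (Lw 0); have := growth_bounds (Lw' 0) => gw' gw.
by move=> t t0; rewrite !block_time_far//; lia.
Qed.

Lemma is_image_lt x y theta s t : is_image x y theta ->
  0 <= s -> s < t -> theta s < theta t.
Proof.
move=> [w [p [q [_ [_ /andP[p0 _]] _ ->]]]] s0 st.
have p0R : (p 0)%:~R <= 0 :> R by rewrite -(ler_int R) in p0.
have := slide_lt (growth f (w 0))%:~R
  (s := s - (p 0)%:~R - 1) (t := t - (p 0)%:~R - 1) ltac:(lra) ltac:(lra).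
by rewrite /block_time; lra.
Qed.

Lemma is_image_step x y theta : is_image x y theta ->
  theta 0 + (C.+1 * C.+2)%:R^-1 <= theta 1.
Proof.
move=> [w [p [q [Lw [_ /andP[p0 _]] _ ->]]]].
have /andP[g0 _] := growth_bounds (Lw 0).
have := slide_step R (absz (p 0)) g0.
have -> : (absz (p 0))%:R = - (p 0)%:~R :> R.
  by rewrite -intrN -[LHS]/((absz (p 0))%:Z%:~R); congr (_%:~R); lia.
rewrite /block_time sub0r (addrC 1) addrK; move: (_^-1) => c; lra.
Qed.

Lemma is_image_surj x y theta v : is_image x y theta ->
  theta 0 <= v <= theta 1 -> exists2 t, 0 <= t <= 1 & theta t = v.
Proof.
move=> [w [p [q [_ [_ /andP[p0 _]] _ ->]]]]; rewrite /block_time.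
have p0R : (p 0)%:~R <= 0 :> R by rewrite -(ler_int R) in p0.
move: (p 0)%:~R p0R (growth f (w 0))%:~R => a a0 d /andP[v0 v1].
exists (slide (- d) (v - a - 1 + d) + a + 1).
  have b0 := slide_bound d (0 - a - 1).
  have h0 := slide_le (- d) (s := slide d (0 - a - 1)) (t := v - a - 1 + d) b0 ltac:(lra).
  have h1 := slide_le (- d) (s := v - a - 1 + d) (t := slide d (1 - a - 1))
    ltac:(lra) ltac:(lra).
  rewrite !slideD (addrC (- d)) subrr !slide0 in h0 h1; [|lra|lra].
  by apply/andP; split; lra.
rewrite (_ : _ + a + 1 - a - 1 = slide (- d) (v - a - 1 + d)); last by ring.
rewrite slideD subrr slide0; first by ring.
have b0 := slide_bound d (0 - a - 1); lra.
Qed.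

Lemma window_mono N M : (N <= M)%N -> (window N <= window M)%N.
Proof. by move=> NM; rewrite /window /preimage_length; nia. Qed.

(** The pair to which the images of the concatenations converge as these approach
    [x].  The times are eventually constant, since window 0 determines them. *)
Definition is_limit_image x y theta := forall N x' y' theta',
  agree (window N) x x' -> is_image x' y' theta' ->
  agree N y y' /\ forall t : R, 0 <= t -> theta t = theta' t.

Lemma marker_shift_image N x : X x ->
  exists x' y' theta', agree (window N) x x' /\ is_image x' y' theta'.
Proof.
move=> /(@marker_shift_approx _ _ _ (window N))[w [p [x' [Lw mx xx']]]].
by have [y' [theta' im]] := is_image_exists Lw mx; exists x', y', theta'.
Qed.

Lemma limit_image_exists x : X x ->
  exists y theta, X y /\ is_limit_image x y theta.
Proof.
move=> Xx.
have /choice[im] : forall N,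
    exists im : fullshift (option A) * fullshift (option A) * (R -> R),
    agree (window N) x im.1.1 /\ is_image im.1.1 im.1.2 im.2.
  by move=> N; have [x' [y' [th h]]] := marker_shift_image N Xx; exists (x', y', th).
move=> imP.
(* The coordinate j of the images is constant from the approximation |j| on. *)
pose y : fullshift (option A) := fun j => (im `|j|%N).1.2 j.
have lim : is_limit_image x y (im 0%N).2.
  move=> N x' y' theta' xx' i'; split.
    move=> j jN; have [xj ij] := imP `|j|%N.
    have [yy' _] := @is_image_local `|j|%N _ _ _ _ _ _ ij i'
      (agree_trans (agree_sym xj) (agreeW (window_mono jN) xx')).
    exact: yy'.
  have [x0 i0] := imP 0%N.
  have [_ //] := @is_image_local 0%N _ _ _ _ _ _ i0 i'
      (agree_trans (agree_sym x0) (agreeW (window_mono (leq0n N)) xx')).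
exists y, (im 0%N).2; split => //.
apply: marker_shift_closed => N; have [xN iN] := imP N.
exists (im N).1.2; last by have [] := lim N _ _ _ xN iN.
by have [w [q [Lw mq]]] := is_image_marked iN; exact: (marker_shift_marked Lw mq).
Qed.
End images.
(** * Self-maps of a mapping torus given by a time change *)

Lemma inc_surj_homeomorphism (R : realType) (phi : R -> R) :
  {homo phi : s t / s < t} -> (forall v, exists t, phi t = v) -> homeomorphism phi.
Proof.
have inc_surj_cont (g : R -> R) : {homo g : s t / s < t} ->
    (forall v, exists t, g t = v) -> continuous g.
  move=> gi gs t; apply/cvgrPdist_lt => e e0.
  have gle a b : (g a < g b) = (a < b).
    by apply/idP/idP => [|/gi//]; rewrite !ltNge; apply: contraNN => /(ltW_homo gi).
  have [a ga] := gs (g t - e / 2); have [b gb] := gs (g t + e / 2).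
  have at_ : a < t by rewrite -gle; lra.
  have tb : t < b by rewrite -gle; lra.
  apply/nbhs_ballP; exists (Num.min (t - a) (b - t)) => /=.
    by rewrite lt_min; apply/andP; split; lra.
  move=> s; rewrite /ball/= lt_min !ltr_norml => /andP[/andP[s1 s2] /andP[s3 s4]].
  have : g a < g s by rewrite gle; lra.
  have : g s < g b by rewrite gle; lra.
  by move=> ? ?; apply/andP; split; lra.
move=> pi ps; have /choice[psi psiK] := ps.
have phile a b : (phi a < phi b) = (a < b).
  by apply/idP/idP => [|/pi//]; rewrite !ltNge; apply: contraNN => /(ltW_homo pi).
have phiK : cancel phi psi.
  move=> t; have := psiK (phi t) => e.
  by case: (ltgtP (psi (phi t)) t) => // /pi; rewrite e ltxx.
exists psi; split => //; apply: inc_surj_cont => //.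
  by move=> s t st; rewrite -phile !psiK.
by move=> t; exists (phi t); rewrite phiK.
Qed.

(** An orbit-preserving self-map of the mapping torus is given by its effect on the
    times in [0, 1]: the class of (x, t) is sent to that of (Y x, theta x t).
    Besides continuity of Y and local constancy of theta, the values at the two
    ends must fit ([Y_cocycle]), and [theta x] must be an increasing bijection
    between intervals, with lengths bounded below so that the times of an orbit
    fill the line. *)
Section time_change.
Variables (R : realType) (S : finType) (X : set (fullshift S)).
Hypothesis shiftX : forall n x, X x -> X (shift n x).
Variables (Y : X -> X) (theta : X -> R -> R) (nu : nat -> nat) (c : R).
Local Notation SX := (mapping_torus R X).
Local Notation sshift := (sshift shiftX).
Local Notation agreeX N x x' := (agree N (\val x) (\val x')).

Hypothesis Y_local : forall N (x x' : X), agreeX (nu N) x x' -> agreeX N (Y x) (Y x').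
Hypothesis theta_local : forall (x x' : X), agreeX (nu 0%N) x x' ->
  forall t : R, 0 <= t -> theta x t = theta x' t.
Hypothesis theta_lt : forall (x : X) (s t : R), 0 <= s -> s < t -> theta x s < theta x t.
Hypothesis c_gt0 : 0 < c.
Hypothesis theta_step : forall x, theta x 0 + c <= theta x 1.
Hypothesis theta_surj : forall x v, theta x 0 <= v <= theta x 1 ->
  exists2 t : R, 0 <= t <= 1 & theta x t = v.
Hypothesis Y_cocycle : forall x,
  torus_pt (Y (sshift 1 x)) (theta (sshift 1 x) 0) = torus_pt (Y x) (theta x 1).

Lemma sshiftD m n x : sshift m (sshift n x) = sshift (m + n) x.
Proof. by apply: val_inj; rewrite /= shiftD. Qed.

Lemma sshift0 x : sshift 0 x = x.
Proof. by apply: val_inj; rewrite /= shift0. Qed.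

(** The time at which the image of [i, i + 1] starts, in the orbit of [Y x]. *)
Definition tile_start (x : X) : int -> R :=
  sval (cid (int_partial_sums
    (fun i => theta (sshift i x) 1 - theta (sshift i x) 0) (theta x 0))).

Lemma tile_start0 x : tile_start x 0 = theta x 0.
Proof. by rewrite /tile_start; case: cid => ? []. Qed.

Lemma tile_startS x i : tile_start x (i + 1) =
  tile_start x i + (theta (sshift i x) 1 - theta (sshift i x) 0).
Proof. by rewrite /tile_start; case: cid => ? []. Qed.

Lemma tile_start1 x : tile_start x 1 = theta x 1.
Proof. by have := tile_startS x 0; rewrite add0r tile_start0 sshift0 => ->; ring. Qed.

Lemma tile_start_step x i : tile_start x i + c <= tile_start x (i + 1).
Proof. by rewrite tile_startS; have := theta_step (sshift i x); lra. Qed.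

Lemma int_ind_step (P : int -> Prop) : P 0 -> (forall i, P i <-> P (i + 1)) ->
  forall i, P i.
Proof.
move=> P0 PS; case=> n; elim: n => [|n ih] //.
- by rewrite -addn1 PoszD; apply: (PS n).1.
- by apply: (PS (Negz 0)).2.
- by apply: (PS (Negz n.+1)).2; rewrite (_ : _ + 1 = Negz n) //; lia.
Qed.

Lemma tile_start_shift x i :
  tile_start x (i + 1) - tile_start x 1 =
  tile_start (sshift 1 x) i - tile_start (sshift 1 x) 0.
Proof.
elim/int_ind_step: i => [|i]; first by rewrite add0r !subrr.
rewrite !tile_startS sshiftD addrAC; split=> h; lra.
Qed.

Definition orbit_time (x : X) (t : R) : R :=
  let i := Num.floor t in
  tile_start x i + theta (sshift i x) (t - i%:~R) - theta (sshift i x) 0.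

Lemma orbit_timeE x i t : i%:~R <= t < i%:~R + 1 ->
  orbit_time x t = tile_start x i + theta (sshift i x) (t - i%:~R) - theta (sshift i x) 0.
Proof. by move=> it; rewrite /orbit_time (@floor_def _ _ i)// intrD1. Qed.

Lemma floorP (t : R) : exists i : int, i%:~R <= t < i%:~R + 1.
Proof. by exists (Num.floor t); have := floor_itv t; rewrite intrD1. Qed.

Lemma orbit_timeE_closed x i t : i%:~R <= t <= i%:~R + 1 ->
  orbit_time x t = tile_start x i + theta (sshift i x) (t - i%:~R) - theta (sshift i x) 0.
Proof.
move=> /andP[it]; rewrite le_eqVlt => /orP[/eqP tE|ti]; last by apply: orbit_timeE; rewrite it.
rewrite (@orbit_timeE x (i + 1)) tE intrD1; last by rewrite lexx; lra.
by rewrite subrr addrK tile_startS (addrC i%:~R) addrK addrA.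
Qed.

Lemma orbit_time_tile x t : 0 <= t <= 1 -> orbit_time x t = theta x t.
Proof.
move=> t01; rewrite (@orbit_timeE_closed x 0) ?add0r// tile_start0 sshift0 subr0.
by rewrite addrAC subrr add0r.
Qed.

Lemma orbit_time_lt x : {homo orbit_time x : s t / s < t}.
Proof.
move=> s t st; have [i /andP[is1 si]] := floorP s; have [j /andP[jt tj]] := floorP t.
rewrite (@orbit_timeE x i) ?is1// (@orbit_timeE x j) ?jt//.
have ij : i <= j.
  by rewrite -ltzD1 -(ltr_int R) intrD1; lra.
have [ijE|ne] := eqVneq i j.
  by rewrite -ijE in jt *; rewrite ltrD2r ltrD2l theta_lt; lra.
have iSj : tile_start x (i + 1) <= tile_start x j.
  have := int_increasing (P := tile_start x) _ j (i + 1).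
  move=> /(_ (fun k => lt_le_trans _ (tile_start_step x k))) H.
  by rewrite leNgt H -?leNgt; [lia|move=> k; rewrite ltrDl].
have h1 := theta_lt (sshift i x) (s := s - i%:~R) (t := 1) ltac:(lra) ltac:(lra).
have h2 : theta (sshift j x) 0 <= theta (sshift j x) (t - j%:~R).
  have : 0 <= t - j%:~R by lra.
  by rewrite le_eqVlt => /orP[/eqP <- //|/theta_lt/ltW]; apply.
by rewrite tile_startS in iSj; lra.
Qed.

Lemma orbit_time_surj x v : exists t, orbit_time x t = v.
Proof.
have [i /andP[iv vi]] := int_locate c_gt0 (tile_start_step x) v.
rewrite tile_startS in vi.
have [|t t01 tE] := @theta_surj (sshift i x) (v - tile_start x i + theta (sshift i x) 0).
  by apply/andP; split; lra.
exists (i%:~R + t); rewrite (@orbit_timeE_closed x i); last by lra.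
by rewrite (_ : i%:~R + t - i%:~R = t) ?tE; ring.
Qed.

Lemma orbit_time_shift x t :
  orbit_time x (t + 1) - tile_start x 1 =
  orbit_time (sshift 1 x) t - tile_start (sshift 1 x) 0.
Proof.
have [i it] := floorP t.
rewrite (@orbit_timeE (sshift 1 x) i)// (@orbit_timeE x (i + 1)) ?intrD1; last by lra.
rewrite sshiftD (_ : t + 1 - (i%:~R + 1) = t - i%:~R); last by ring.
by have := tile_start_shift x i; lra.
Qed.

Definition lifted (x : X) (t : R) : SX := torus_pt (Y x) (orbit_time x t).

Lemma lifted_shift (n : int) x t : lifted (sshift n x) t = lifted x (t + n%:~R).
Proof.
have step y s : lifted (sshift 1 y) s = lifted y (s + 1).
  have := orbit_time_shift y s; set a := tile_start _ 0; set b := tile_start _ 1 => ab.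
  have -> : lifted (sshift 1 y) s =
      flow (orbit_time (sshift 1 y) s - a) (torus_pt (Y (sshift 1 y)) a).
    by rewrite flow_torus_pt addrC subrK.
  rewrite -ab /a tile_start0 Y_cocycle flow_torus_pt /lifted; congr torus_pt.
  by rewrite /b tile_start1; lra.
elim/int_ind_step: n x t => [x t|n]; first by rewrite sshift0 addr0.
split=> h x t.
  by rewrite intrD1 (addrC n) -sshiftD step h; congr lifted; ring.
have := h x (t - 1); rewrite (addrC n) -sshiftD step subrK => ->.
by congr lifted; rewrite intrD; ring.
Qed.

Definition time_changed (z : SX) : SX := lifted (repr z).1 (repr z).2.

Lemma time_changed_torus_pt x t : time_changed (torus_pt x t) = lifted x t.
Proof.
rewrite /time_changed; have := torus_ptE (repr (torus_pt x t)).
rewrite reprK; case: (repr _) => y s /=.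
move=> /(eq_torus_pt shiftX)[n [-> ->]].
by rewrite lifted_shift subrK.
Qed.

Lemma time_changed_tile x t : 0 <= t <= 1 ->
  time_changed (torus_pt x t) = torus_pt (Y x) (theta x t).
Proof. by move=> t01; rewrite time_changed_torus_pt /lifted orbit_time_tile. Qed.

Lemma time_changed_orientation : orientation_preserving time_changed.
Proof.
move=> z; have [x [t ->]] := torus_ptP z.
exists (fun r => orbit_time x (t + r) - orbit_time x t); split.
- apply: inc_surj_homeomorphism => [r s rs|v].
    by rewrite ltrD2r; apply: orbit_time_lt; rewrite ltrD2l.
  have [s sE] := orbit_time_surj x (v + orbit_time x t).
  by exists (s - t); rewrite (addrC t) subrK sE addrK.
- by move=> r s rs; rewrite ltrD2r; apply: orbit_time_lt; rewrite ltrD2l.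
- by move=> r; rewrite flow_torus_pt !time_changed_torus_pt /lifted flow_torus_pt; congr torus_pt; lra.
Qed.

Lemma tile_start_local (m : nat) (x x' : X) (i : int) : (`|i| <= m)%N ->
  agreeX (nu 0 + m)%N x x' -> tile_start x i = tile_start x' i.
Proof.
move=> im xx'.
have th k t : (`|k| <= m)%N -> 0 <= t -> theta (sshift k x) t = theta (sshift k x') t.
  move=> km t0; apply: theta_local => //; apply: agree_shift.
  by apply: agreeW xx'; rewrite leq_add2l.
have th0 k : (`|k| <= m)%N -> theta (sshift k x) 0 = theta (sshift k x') 0.
  by move=> km; exact: th.
have th1 k : (`|k| <= m)%N -> theta (sshift k x) 1 = theta (sshift k x') 1.
  by move=> km; exact: th.
have z : tile_start x 0 = tile_start x' 0.
  by rewrite !tile_start0 -(sshift0 x) -(sshift0 x') th0.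
case: i im => k; elim: k => [//|k ih] km.
- rewrite (_ : k.+1%:Z = k%:Z + 1) in km *; last by lia.
  by rewrite !tile_startS ih ?th0 ?th1//; lia.
- have := tile_startS x (Negz 0); have := tile_startS x' (Negz 0).
  by rewrite [Negz 0 + 1](_ : _ = 0)// z th0// th1//; lra.
- have := tile_startS x (Negz k.+1); have := tile_startS x' (Negz k.+1).
  rewrite [Negz k.+1 + 1](_ : _ = Negz k); last by lia.
  by rewrite ih ?th0 ?th1//; [lra|lia].
Qed.

Lemma orbit_time_local (m : nat) (x x' : X) (t : R) : `|t| <= m%:R ->
  agreeX (nu 0 + m.+1)%N x x' -> orbit_time x t = orbit_time x' t.
Proof.
move=> tm xx'; have [i it] := floorP t.
have im : (`|i| <= m.+1)%N.
  have : `|i%:~R : R| < m.+2%:Z%:~R.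
    rewrite -[_%:~R in X in _ < X]/(m.+2%:R) -!natr1.
    move: tm it; rewrite ler_norml ltr_norml => /andP[? ?] /andP[? ?].
    by apply/andP; split; lra.
  by rewrite -intr_norm ltr_int; lia.
rewrite !(@orbit_timeE _ i)// (tile_start_local im xx').
have h s : 0 <= s -> theta (sshift i x) s = theta (sshift i x') s.
  by apply: theta_local; apply: agree_shift; apply: agreeW xx'; rewrite leq_add2l.
by rewrite !h//; lra.
Qed.

Lemma orbit_time_continuous x : continuous (orbit_time x).
Proof.
by have [g []] := inc_surj_homeomorphism (@orbit_time_lt x) (orbit_time_surj x).
Qed.

(** On a bounded interval of times, [orbit_time x] is the same function for all x
    close to a given one, so only its continuity in t matters. *)
Lemma time_changed_continuous : continuous time_changed.
Proof.
move=> z; have [x [t ->]] := torus_ptP z.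
move=> U; rewrite /= time_changed_torus_pt => /(nbhs_torus_pt shiftX)[N [e e0 HU]].
have : nbhs t [set s | `|orbit_time x t - orbit_time x s| < e].
  have /cvgrPdist_lt/(_ e e0) := @orbit_time_continuous x t.
  by apply: filterS.
move=> /nbhs_ballP[d /= d0 Hd].
have [m tm] : exists m : nat, `|t| + 1 <= m%:R.
  exists (Num.bound (`|t| + 1)); apply/ltW/archi_boundP.
  by have := normr_ge0 t; lra.
apply/(nbhs_torus_pt shiftX).
exists (maxn (nu N) (nu 0 + m.+1)), (Num.min d 1); first by rewrite lt_min d0 ltr01.
move=> x' s xx' /=; rewrite lt_min => /andP[tsd ts1]; rewrite time_changed_torus_pt.
apply: HU; first by apply: Y_local; apply: agreeW xx'; rewrite leq_maxl.
rewrite -(@orbit_time_local m x x'); first exact: Hd.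
  have := ler_normD (s - t) t; rewrite subrK distrC; lra.
by apply: agreeW xx'; rewrite leq_maxr.
Qed.
End time_change.
(** * The self-map induced by a prefix rewriting *)

Section rewriting_flow.
Variables (R : realType) (A : finType) (L : set (seq A)).
Local Notation X := (marker_shift L).
Local Notation SX := (mapping_torus R X).
Let shiftX : forall n x, X x -> X (shift n x) := @marker_shift_shift A L.
Local Notation sshift := (sshift shiftX).

(** Orbits of concatenations are dense, and the mapping torus is Hausdorff. *)
Lemma marked_dense (F1 F2 : SX -> SX) : continuous F1 -> continuous F2 ->
  (forall w p (x : X) t, (forall i, L (w i)) -> marked w p (\val x) ->
     F1 (torus_pt x t) = F2 (torus_pt x t)) -> F1 = F2.
Proof.
move=> c1 c2 F12; apply/funext => z; apply: (mapping_torus_hausdorff shiftX).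
have [x [t ->]] := torus_ptP z => U V /c1/(nbhs_torus_pt shiftX)[N [e e0 HU]].
move=> /c2/(nbhs_torus_pt shiftX)[M [e' e0' HV]].
have [w [p [x' [Lw mx xx']]]] := marker_shift_approx (maxn N M) (set_mem (valP x)).
pose x1 : X := SigSub (mem_set (marker_shift_marked Lw mx)).
exists (F1 (torus_pt x1 t)); split.
  by apply: HU; rewrite ?subrr ?normr0//; apply: agreeW xx'; rewrite leq_maxl.
rewrite (F12 w p)//.
by apply: HV; rewrite ?subrr ?normr0//; apply: agreeW xx'; rewrite leq_maxr.
Qed.

Variables (f : seq A -> seq A) (n C : nat) (pre : seq A -> seq A).
Hypothesis fP : prefix_rewriting L f n C pre.

(** The limit images are the data of a time change.  Its conditions are of two
    sorts.  Those on theta pass from concatenations to their limits because theta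
    is locally constant; the compatibility of the ends does because its two sides
    are continuous in x.  On a concatenation it says that leaving a block at its
    end and entering the next one at its marker give the same point. *)
Lemma rewriting_flow_exists : exists F : SX -> SX,
  [/\ continuous F, orientation_preserving F &
  forall w p (x : X) q (y : X) (i : int) (t : R), (forall i, L (w i)) ->
    marked w p (\val x) -> marked (f \o w) q (\val y) ->
    (p i)%:~R <= t <= (p (i + 1))%:~R ->
    F (torus_pt x t) = torus_pt y (slide (growth f (w i))%:~R (t - (p i)%:~R - 1) + (q i)%:~R + 1)].
Proof.
have /choice[Yt lim] : forall x : X, exists yt : X * (R -> R),
    is_limit_image L f n C (\val x) (\val yt.1) yt.2.
  move=> x; have [y [th [Xy h]]] := limit_image_exists R fP (set_mem (valP x)).
  by exists (SigSub (mem_set Xy), th).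
pose Y x := (Yt x).1; pose theta x := (Yt x).2.
have approx N (x : X) : exists x' y' theta', [/\ agree (window n C N) (\val x) x',
    is_image L f x' y' theta', agree N (\val (Y x)) y' &
    forall t : R, 0 <= t -> theta x t = theta' t].
  have [x' [y' [th [xx' im]]]] := marker_shift_image R f n C N (set_mem (valP x)).
  by have [] := lim x _ _ _ _ xx' im; exists x', y', th.
have Y_local N (x x' : X) : agree (window n C N) (\val x) (\val x') ->
    agree N (\val (Y x)) (\val (Y x')).
  move=> xx'; have [x1 [y1 [th1 [xx1 im Yy1 _]]]] := approx N x.
  have [x1x _] := lim x' _ _ _ _ (agree_trans (agree_sym xx') xx1) im.
  exact: agree_trans Yy1 (agree_sym x1x).
have theta_local (x x' : X) : agree (window n C 0) (\val x) (\val x') ->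
    forall t, 0 <= t -> theta x t = theta x' t.
  move=> xx' t t0; have [x1 [y1 [th1 [xx1 im _ th]]]] := approx 0%N x.
  have [_ x1x] := lim x' _ _ _ _ (agree_trans (agree_sym xx') xx1) im.
  by rewrite th// -x1x.
have theta_lt x s t : 0 <= s -> s < t -> theta x s < theta x t.
  move=> s0 st; have [x1 [y1 [th1 [_ im _ th]]]] := approx 0%N x.
  by rewrite !th//; [exact: is_image_lt im _ _|lra].
have theta_step x : theta x 0 + (C.+1 * C.+2)%:R^-1 <= theta x 1.
  have [x1 [y1 [th1 [_ im _ th]]]] := approx 0%N x.
  by rewrite !th//; exact: (is_image_step fP im).
have theta_surj x v : theta x 0 <= v <= theta x 1 ->
    exists2 t, 0 <= t <= 1 & theta x t = v.
  have [x1 [y1 [th1 [_ im _ th]]]] := approx 0%N x.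
  rewrite !th// => /(is_image_surj im)[t t01 tE]; exists t => //.
  by rewrite th//; case/andP: t01.
have c_gt0 : 0 < (C.+1 * C.+2)%:R^-1 :> R by rewrite invr_gt0 ltr0n.
have block w p (x : X) q (y : X) (i k : int) t : (forall i, L (w i)) ->
    marked w p (\val x) -> marked (f \o w) q (\val y) -> p i <= k < p (i + 1) -> 0 <= t ->
    torus_pt (Y (sshift k x)) (theta (sshift k x) t) =
    torus_pt y (slide (growth f (w i))%:~R (t + k%:~R - (p i)%:~R - 1) + (q i)%:~R + 1).
  move=> Lw mx my ik t0; set m := q (i + 1) - p (i + 1) + k.
  have im := is_image_block R Lw mx my ik; rewrite -/m in im.
  have limk N := lim (sshift k x) N _ _ _ (fun _ _ => erefl) im.
  have -> : Y (sshift k x) = sshift m y.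
    by apply: val_inj; apply/funext => j; apply: (limk `|j|%N).1.
  rewrite torus_pt_shift; congr torus_pt.
  have -> : theta (sshift k x) t = block_time (p i - k) (growth f (w i)) t.
    exact: (limk 0%N).2 t t0.
  have mE : m%:~R = (q i)%:~R - (p i)%:~R + (growth f (w i))%:~R + k%:~R :> R.
    rewrite -intrB -!intrD; congr (_%:~R); rewrite /m /growth.
    by rewrite (marked_next mx) (marked_next my) /=; lia.
  by rewrite mE /block_time intrB (_ : t - _ - 1 = t + k%:~R - (p i)%:~R - 1); ring.
(* The right end of a block is mapped to the right end of its image. *)
have edge w p q (x y : fullshift (option A)) i : (forall i, L (w i)) ->
    marked w p x -> marked (f \o w) q y ->
    slide (growth f (w i))%:~R ((p (i + 1))%:~R - (p i)%:~R - 1) + (q i)%:~R + 1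
    = (q (i + 1))%:~R :> R.
  move=> Lw mx my; rewrite (marked_next mx) (marked_next my) /=.
  have sE m : (m.+1%:Z)%:~R = m%:R + 1 :> R by rewrite natr1.
  have gE : (growth f (w i))%:~R = (size (f (w i)))%:R - (size (w i))%:R :> R.
    by rewrite intrB.
  rewrite gE !intrD !sE slide_translation.
  - by ring.
  - by rewrite (_ : _ - 1 = (size (w i))%:R) ?ler0n//; ring.
  - by rewrite (_ : _ - 1 + _ = (size (f (w i)))%:R) ?ler0n//; ring.
have Y_cocycle x :
    torus_pt (Y (sshift 1 x)) (theta (sshift 1 x) 0) = torus_pt (Y x) (theta x 1).
  apply: (mapping_torus_hausdorff shiftX) => U V.
  move=> /(nbhs_torus_pt shiftX)[N [e e0 HU]] /(nbhs_torus_pt shiftX)[M [e' e0' HV]].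
  pose K := (maxn (window n C N) (window n C M) + window n C 0).+1.
  have [w [p [x' [Lw mx xx']]]] := marker_shift_approx K (set_mem (valP x)).
  pose x1 : X := SigSub (mem_set (marker_shift_marked Lw mx)).
  have [q [y [my _]]] := marked_exists (f \o w) 0.
  have Lfw i : L ((f \o w) i) by exact: rewriting_stable fP _ (Lw i).
  pose y1 : X := SigSub (mem_set (marker_shift_marked Lfw my)).
  have [i i0] := marked_block mx 0.
  have xx0 : agree (window n C 0) (\val x) (\val x1).
    by apply: agreeW xx'; rewrite /K; lia.
  have sxx k N' : (`|k| <= 1)%N -> (N' < K)%N ->
      agree N' (\val (sshift k x)) (\val (sshift k x1)).
    by move=> k1 NK; apply: agree_shift; apply: agreeW xx'; lia.
  exists (torus_pt (Y (sshift 1 x1)) (theta (sshift 1 x1) 0)); split.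
    apply: HU; first by apply: Y_local; apply: sxx => //; rewrite /K; lia.
    rewrite (theta_local _ (sshift 1 x1)) ?subrr ?normr0//.
    by apply: sxx => //; rewrite /K; lia.
  have -> : torus_pt (Y (sshift 1 x1)) (theta (sshift 1 x1) 0) = torus_pt (Y x1) (theta x1 1).
    rewrite -{3 4}(sshift0 shiftX x1) (block _ _ x1 _ y1 i 0 1 Lw mx my i0 ler01).
    have [i1|i1] := ltrP 1 (p (i + 1)).
      rewrite (block _ _ x1 _ y1 i 1 0 Lw mx my _ (lexx _)).
        by congr torus_pt; rewrite add0r addr0.
      by move: i0 i1; move: (p i) (p (i + 1)) => *; lia.
    have p1 : p (i + 1) = 1 by move: i0 i1; move: (p i) (p (i + 1)) => *; lia.
    rewrite (block _ _ x1 _ y1 (i + 1) 1 0 Lw mx my _ (lexx _)); last first.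
      by rewrite p1 (marked_next mx) p1; lia.
    congr torus_pt; rewrite p1 add0r subrr sub0r slide_bot addrAC addNr add0r addr0.
    by rewrite -(edge _ _ _ _ _ i Lw mx my) p1.
  apply: HV; first by apply: Y_local; apply: agreeW xx'; rewrite /K; lia.
  by rewrite (theta_local x x1) ?subrr ?normr0.
pose F := time_changed shiftX Y theta.
exists F; split.
- exact: (time_changed_continuous Y_local theta_local theta_lt c_gt0 theta_step
    theta_surj Y_cocycle).
- exact: (time_changed_orientation theta_lt c_gt0 theta_step theta_surj Y_cocycle).
have Fopen w p (x : X) q (y : X) (i : int) (t : R) : (forall i, L (w i)) ->
    marked w p (\val x) -> marked (f \o w) q (\val y) ->
    (p i)%:~R <= t < (p (i + 1))%:~R ->
    F (torus_pt x t) = torus_pt y (slide (growth f (w i))%:~R (t - (p i)%:~R - 1) + (q i)%:~R + 1).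
  move=> Lw mx my /andP[it ti]; have [k /andP[kt tk]] := floorP t.
  have -> : torus_pt x t = torus_pt (sshift k x) (t - k%:~R) by rewrite torus_pt_shift subrK.
  rewrite /F (time_changed_tile c_gt0 Y_cocycle); last by lra.
  rewrite (block w p x q y i k (t - k%:~R) Lw mx my) ?subrK//; last by lra.
  by rewrite -ltzD1 -!(ltr_int R) !intrD1; apply/andP; split; lra.
move=> w p x q y i t Lw mx my /andP[it]; rewrite le_eqVlt => /orP[/eqP ->|ti].
  rewrite (Fopen _ _ _ _ _ (i + 1) _ Lw mx my); last first.
    by rewrite lexx ltr_int (marked_lt mx) ltrDl.
  by rewrite subrr sub0r slide_bot addrAC addNr add0r -(edge _ _ _ _ _ i Lw mx my).
by apply: Fopen; rewrite ?it.
Qed.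
End rewriting_flow.
(** * The action of the group and its faithfulness *)

Section veelike_actions.
Variables (R : realType) (A : finType) (G : groupType) (L : set (seq A)).
Variable act : G -> L -> L.
Local Notation X := (marker_shift L).
Local Notation SX := (mapping_torus R X).
Let shiftX : forall n x, X x -> X (shift n x) := @marker_shift_shift A L.

(** The action as a self-map of the set of all words, extended by the identity. *)
Definition act_word (g : G) (u : seq A) : seq A :=
  if pselect (L u) is left Lu then \val (act g (SigSub (mem_set Lu))) else u.

Lemma act_word_val g (v : L) : act_word g (\val v) = \val (act g v).
Proof.
rewrite /act_word; case: pselect => [Lv|[]]; last exact: set_mem (valP v).
by congr (\val (act g _)); apply: val_inj.
Qed.

Lemma act_word_stable g u : L u -> L (act_word g u).
Proof.
by move=> Lu; rewrite (act_word_val g (SigSub (mem_set Lu))); exact: set_mem (valP _).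
Qed.

Lemma bounded_on_short_words (h : seq A -> nat) n :
  exists C, forall u, (size u <= n)%N -> (h u <= C)%N.
Proof.
elim: n h => [|n ih] h.
  by exists (h [::]) => u; rewrite leqn0 size_eq0 => /eqP ->.
have /choice[C CP] := fun a : A => ih (fun u => h (a :: u)).
exists (maxn (h [::]) (\max_(a : A) C a)) => -[|a u] su; first exact: leq_maxl.
apply: leq_trans (leq_maxr _ _); apply: leq_trans (CP a u su) _.
exact: leq_bigmax.
Qed.

Hypothesis act_veelike : veelike act.

Lemma act_word_rewriting g :
  exists n C pre, prefix_rewriting L (act_word g) n C pre.
Proof.
have [n nP] := act_veelike g.
have /choice[pre preP] : forall u : seq A, exists u' : seq A, size u = n ->
    forall (v : seq A) (w : L), \val w = u ++ v -> \val (act g w) = u' ++ v.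
  move=> u; have [un|un] := eqVneq (size u) n; last first.
    by exists [::] => /eqP; rewrite (negbTE un).
  by have [u' u'P] := nP u un; exists u'.
have [C1 C1P] := bounded_on_short_words (fun u => size (act_word g u)) n.
have [C2 C2P] := bounded_on_short_words (fun u => size (pre u)) n.
have pr w : L w -> (n <= size w)%N -> act_word g w = pre (take n w) ++ drop n w.
  move=> Lw nw; rewrite (act_word_val g (SigSub (mem_set Lw))).
  by apply: preP; [rewrite size_takel|rewrite cat_take_drop].
exists n, (n + C1 + C2)%N, pre; split => //.
- exact: act_word_stable.
- move=> w Lw; have [nw|wn] := leqP n (size w).
    rewrite pr// size_cat size_drop; have := C2P (take n w).
    by rewrite size_takel// leqnn => /(_ isT); lia.
  by have := C1P w (ltnW wn); lia.
- move=> w Lw; have [nw|wn] := leqP n (size w); last by lia.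
  by rewrite pr// size_cat size_drop; lia.
Qed.

Lemma act_flow_exists g : exists F : SX -> SX,
  [/\ continuous F, orientation_preserving F &
  forall w p (x : X) q (y : X) (i : int) (t : R), (forall i, L (w i)) ->
    marked w p (\val x) -> marked (act_word g \o w) q (\val y) ->
    (p i)%:~R <= t <= (p (i + 1))%:~R ->
    F (torus_pt x t) =
    torus_pt y (slide (growth (act_word g) (w i))%:~R (t - (p i)%:~R - 1) + (q i)%:~R + 1)].
Proof.
by have [n [C [pre P]]] := act_word_rewriting g; exact: (rewriting_flow_exists R P).
Qed.

(** By density, a continuous map is determined by its values on concatenations, so
    any choice satisfies the relations that hold there. *)
Definition act_flow g : SX -> SX := sval (cid (act_flow_exists g)).

Lemma act_flow_continuous g : continuous (act_flow g).
Proof. by rewrite /act_flow; case: cid => F /= []. Qed.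

Lemma act_flow_orientation g : orientation_preserving (act_flow g).
Proof. by rewrite /act_flow; case: cid => F /= []. Qed.

Lemma act_flow_marked g w p (x : X) q (y : X) (i : int) (t : R) :
  (forall i, L (w i)) -> marked w p (\val x) ->
  marked (act_word g \o w) q (\val y) -> (p i)%:~R <= t <= (p (i + 1))%:~R ->
  act_flow g (torus_pt x t) =
  torus_pt y (slide (growth (act_word g) (w i))%:~R (t - (p i)%:~R - 1) + (q i)%:~R + 1).
Proof. by rewrite /act_flow; case: cid => F /= [_ _]; apply. Qed.

Hypothesis actP : is_action act.

Lemma act_word1 u : L u -> act_word 1%g u = u.
Proof. by move=> Lu; rewrite (act_word_val _ (SigSub (mem_set Lu))) actP.1. Qed.

Lemma act_wordM g h u : L u -> act_word (g * h)%g u = act_word g (act_word h u).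
Proof.
move=> Lu.
by rewrite !(act_word_val _ (SigSub (mem_set Lu))) actP.2 act_word_val.
Qed.

Lemma marked_tile w p (x : X) (t : R) : marked w p (\val x) ->
  exists i, (p i)%:~R <= t <= (p (i + 1))%:~R.
Proof.
move=> mx; have [|i /andP[it ti]] := @int_locate R 1 (fun i => (p i)%:~R) ltr01 _ t.
  by move=> i; rewrite (marked_next mx) -intrD1 ler_int; lia.
by exists i; rewrite it ltW.
Qed.

Lemma act_flow1 : act_flow 1%g = idfun.
Proof.
apply: marked_dense; [exact: act_flow_continuous|by move=> z|].
move=> w p x t Lw mx; have [i it] := marked_tile t mx.
have wE : act_word 1%g \o w = w by apply/funext => j /=; rewrite act_word1.
rewrite (act_flow_marked (q := p) (y := x) Lw mx _ it) ?wE//=.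
rewrite /growth act_word1// subrr slide0; last by lra.
by congr torus_pt; lra.
Qed.

(** The growths of w under h and of h w under g add up to the growth under g h, so
    [slideD] gives the equality on concatenations. *)
Lemma act_flowM g h : act_flow (g * h)%g = act_flow g \o act_flow h.
Proof.
apply: marked_dense; first exact: act_flow_continuous.
  by move=> z; apply: continuous_comp; exact: act_flow_continuous.
move=> w p x t Lw mx /=; have [i it] := marked_tile t mx.
have Lhw j : L ((act_word h \o w) j) by exact: act_word_stable.
have Lghw j : L ((act_word g \o (act_word h \o w)) j) by exact: act_word_stable.
have [q [y0 [my _]]] := marked_exists (act_word h \o w) 0.
have [r [z0 [mz _]]] := marked_exists (act_word g \o (act_word h \o w)) 0.
pose y : X := SigSub (mem_set (marker_shift_marked Lhw my)).
pose z : X := SigSub (mem_set (marker_shift_marked Lghw mz)).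
rewrite (act_flow_marked (q := q) (y := y) Lw mx my it).
rewrite (act_flow_marked (x := y) (q := r) (y := z) (i := i) Lhw my mz).
  have ghE : act_word (g * h)%g \o w = act_word g \o (act_word h \o w).
    by apply/funext => j /=; rewrite act_wordM.
  rewrite (act_flow_marked (q := r) (y := z) Lw mx _ it) ?ghE//.
  congr torus_pt; set s := slide (growth (act_word h) (w i))%:~R _.
  have -> : s + (q i)%:~R + 1 - (q i)%:~R - 1 = s by ring.
  rewrite /s.
  rewrite slideD -intrD /growth /= act_wordM//.
  by congr (slide _%:~R _ + _ + _); lia.
set d := (growth _ _)%:~R.
move: it; rewrite (marked_next mx) (marked_next my) /= !intrD => it.
have dE : d = (size (act_word h (w i)))%:R - (size (w i))%:R by rewrite /d intrB.
clearbody d; have sE m : (m.+1%:Z)%:~R = m%:R + 1 :> R by rewrite natr1.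
rewrite !sE in it *; have b := slide_bound d (t - (p i)%:~R - 1).
apply/andP; split; first by lra.
have : slide d (t - (p i)%:~R - 1) <= slide d (size (w i))%:R by apply: slide_le; lra.
have f0 : 0 <= (size (act_word h (w i)))%:R :> R by exact: ler0n.
have -> : slide d (size (w i))%:R = (size (w i))%:R + d.
  by apply: slide_translation; [exact: ler0n|lra].
by move=> h1; lra.
Qed.

Lemma act_flow_ophomeo g : ophomeo_set (act_flow g).
Proof.
split; last exact: act_flow_orientation.
exists (act_flow g^-1%g); split; try exact: act_flow_continuous.
  move=> z; rewrite -[LHS]/((act_flow g^-1%g \o act_flow g) z).
  by rewrite -act_flowM mulVg act_flow1.
move=> z; rewrite -[LHS]/((act_flow g \o act_flow g^-1%g) z).
by rewrite -act_flowM mulgV act_flow1.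
Qed.

Definition act_ophomeo g : ophomeo R X := SigSub (mem_set (act_flow_ophomeo g)).

Lemma act_ophomeo1 : act_ophomeo 1%g = 1%g.
Proof. by apply: val_inj; exact: act_flow1. Qed.

Lemma act_ophomeoM g h : act_ophomeo (g * h)%g = (act_ophomeo g * act_ophomeo h)%g.
Proof. by apply: val_inj; exact: act_flowM. Qed.

Lemma isotopic_same_orbit (f g : ophomeo R X) z : isotopic f g ->
  exists r, \val g z = flow r (\val f z).
Proof.
move=> /asboolP[h [ch _ h0 h1]].
(* The retraction of the line onto [0, 1], to extend the isotopy to all times. *)
pose clamp (r : R) := (`|r| - `|r - 1| + 1) / 2.
have clamp_cont : continuous clamp.
  move=> r; apply: cvgM; last exact: cvg_cst.
  apply: cvgD; last exact: cvg_cst.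
  apply: cvgB; apply: cvg_norm; first exact: cvg_id.
  by apply: cvgB; [exact: cvg_id|exact: cvg_cst].
have clamp01 r : 0 <= clamp r <= 1.
  rewrite /clamp; case: (ler0P r) => r0; case: (ler0P (r - 1)) => r1; lra.
pose c r := h (clamp r, z).
have cc : continuous c.
  apply/continuous_subspace_setT.
  apply: (within_comp ch) => [r|r _].
    apply: (@cvg_pair _ _ _ _ (nbhs (clamp r)) (nbhs z)); last exact: cvg_cst.
    exact: clamp_cont.
  by split => //=; rewrite in_itv /=; exact: clamp01.
have [r] := path_in_orbit shiftX cc 1.
have -> : c 1 = \val g z.
  by rewrite /c /clamp -h1 subrr normr0 normr1 (_ : _ / 2 = 1)//; lra.
have -> : c 0 = \val f z.
  by rewrite /c /clamp -h0 sub0r normr0 normrN normr1 (_ : _ / 2 = 0)//; lra.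
by exists r.
Qed.

(** The periodic configuration made of blocks u is sent, up to the flow, to the one
    made of blocks g u.  Markers delimit the blocks, so a shift of the former can
    be equal to the latter only if g u = u. *)
Lemma act_flow_faithful g : faithful_action act ->
  isotopic (act_ophomeo g) 1%g -> g = 1%g.
Proof.
move=> faith iso; apply: faith => u; apply: val_inj.
rewrite -act_word_val; set v := \val u; have Lv : L v := set_mem (valP u).
pose w (i : int) := v; have Lw i : L (w i) by [].
have Lgw i : L ((act_word g \o w) i) by exact: act_word_stable.
have [p [x0 [mx p0]]] := marked_exists w 0.
have [q [y0 [my q0]]] := marked_exists (act_word g \o w) 0.
pose x : X := SigSub (mem_set (marker_shift_marked Lw mx)).
pose y : X := SigSub (mem_set (marker_shift_marked Lgw my)).
have [r] := isotopic_same_orbit (torus_pt x 0) iso.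
rewrite /= (act_flow_marked (x := x) (q := q) (y := y) (i := 0) Lw mx my); last first.
  by rewrite (marked_next0 mx) p0 lexx add0r ler0z.
rewrite flow_torus_pt => /(eq_torus_pt shiftX)[n [yE _]].
have {}yE : y0 = shift n x0 by have := congr1 val yE.
have mx' := marked_shift mx n.
have [j pj] : exists j, p j - n = q 0.
  by apply: (marked_None mx'); rewrite -yE (marked_marker my).
apply/esym; apply: (marked_eq_block mx' my (i := j) (i' := 0) (m := (size v).+1)) => [k _|].
  by rewrite pj yE.
by rewrite ltnSn.
Qed.

Lemma MCG_embedding : faithful_action act ->
  exists f : {multiplicative G -> MCG R X}, injective f.
Proof.
move=> faith.
pose f g := (\pi_(MCG R X) (act_ophomeo g))%qT.
have fM : {morph f : g h / (g * h)%g}.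
  move=> g h; rewrite /f act_ophomeoM; exact/esym/MCGM_pi.
pose fm := isMultiplicative.Build G (MCG R X) f fM.
pose F : {multiplicative G -> MCG R X} := HB.pack f fm.
exists F => g h /= fgh.
suff : (h^-1 * g)%g = 1%g.
  by move/(congr1 (fun k => h * k)%g); rewrite mulgA mulgV mul1g mulg1.
apply: act_flow_faithful => //.
have : f (h^-1 * g)%g = f 1%g.
  by rewrite fM fgh -fM mulVg.
by move=> /eqmodP; rewrite act_ophomeo1.
Qed.
End veelike_actions.

Theorem theorem3 (R : realType) (A : finType) (G : groupType)
    (L : set (seq A)) (act : G -> L -> L) :
  is_action act -> faithful_action act -> veelike act ->
  exists f : {multiplicative G -> MCG R (marker_shift L)}, injective f.
Proof. by move=> actP faith vee; exact: MCG_embedding vee actP faith. Qed.
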